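(* Let $R$ be a ring and let $\mathbb{F}$ be a class of $R$-left-modules (closed under isomorphisms) which is closed under pure quotient modules. Then the following conditions are equivalent. (i) $\mathbb{F}$ is closed under set indexed direct sums. (ii) $\mathbb{F}$ is precovering. (iii) $\mathbb{F}$ is covering.
   Context: $R$ is a ring, and ''class'' means a class of $R$-left-modules closed under isomorphisms. A short exact sequence $0 \to M' \to M \to M'' \to 0$ of $R$-left-modules is pure exact if it stays exact when tensored with any $R$-right-module; then $M'$ is called a pure submodule and $M''$ a pure quotient module of $M$. A class is closed under pure quotient modules if each pure quotient module of a module in the class is in the class. An $\mathbb{F}$-precover of an $R$-left-module $M$ is a homomorphism $F \to M$ with $F$ in $\mathbb{F}$ such that each homomorphism $F' \to M$ with $F'$ in $\mathbb{F}$ factors as $F' \to F \to M$. An $\mathbb{F}$-cover of $M$ is an $\mathbb{F}$-precover $F \to M$ such that each endomorphism $F \to F$ for which the composite $F \to F \to M$ equals $F \to M$ is an automorphism. The class $\mathbb{F}$ is precovering (respectively covering) if each $R$-left-module has an $\mathbb{F}$-precover (respectively an $\mathbb{F}$-cover). *)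

(* Defs.v *)
From HB Require Import structures.
From mathcomp Require Import all_boot all_algebra.
From mathcomp Require Import boolp classical_sets functions cardinality.
From mathcomp.multinomials Require Import freeg.

Set Implicit Arguments.
Unset Strict Implicit.
Unset Printing Implicit Defensive.

Import GRing.Theory.
Local Open Scope ring_scope.
Local Open Scope quotient_scope.

(* [pzRingType] is an arbitrary unital ring, the zero ring included. Left      *)
(* modules over [R] are [lmodType R]; right modules over [R] are left modules  *)
(* over the converse ring, [lmodType R^c], the product [n . r] being written   *)
(* [(r : R^c) *: n].                                                           *)

Section TensorProduct.
Variables (R : pzRingType) (N : lmodType R^c) (M : lmodType R).

Inductive tensor_rel : {freeg (N * M)%type} -> Prop :=
| tensor_rel0 : tensor_rel 0
| tensor_relB x y : tensor_rel x -> tensor_rel y -> tensor_rel (x - y)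
| tensor_rel_addl n1 n2 m :
    tensor_rel (<< (n1 + n2, m) >> - (<< (n1, m) >> + << (n2, m) >>))
| tensor_rel_addr n m1 m2 :
    tensor_rel (<< (n, m1 + m2) >> - (<< (n, m1) >> + << (n, m2) >>))
| tensor_rel_bal n (r : R) m :
    tensor_rel (<< ((r : R^c) *: n, m) >> - << (n, r *: m) >>).

Definition tensor_relb : {pred {freeg (N * M)%type}} :=
  fun x => `[< tensor_rel x >].

Fact tensor_relb_closed : zmod_closed tensor_relb.
Proof.
split=> [|x y /asboolP xr /asboolP yr]; apply/asboolP; first exact: tensor_rel0.
exact: tensor_relB.
Qed.

HB.instance Definition _ :=
  GRing.isZmodClosed.Build {freeg (N * M)%type} tensor_relb tensor_relb_closed.

Definition tensor : Type := Quotient.quot tensor_relb.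

HB.instance Definition _ := GRing.Zmodule.on tensor.

Definition tens (n : N) (m : M) : tensor :=
  \pi_(Quotient.quot tensor_relb) << (n, m) >>.

Definition balanced (V : zmodType) (b : N -> M -> V) :=
  [/\ forall n1 n2 m, b (n1 + n2) m = b n1 m + b n2 m,
      forall n m1 m2, b n (m1 + m2) = b n m1 + b n m2
    & forall n (r : R) m, b ((r : R^c) *: n) m = b n (r *: m)].

(* Meaningful for [b] balanced only; see [tensor_liftE] and [tensor_lift_uniq] *)
(* for the universal property.                                                 *)
Definition tensor_lift (V : zmodType) (b : N -> M -> V) (x : tensor) : V :=
  fglift (fun p : N * M => b p.1 p.2 : zmodule V)
         (repr (x : Quotient.quot tensor_relb)).

Lemma tens_balanced : balanced tens.
Proof.
rewrite /tens; split=> [n1 n2 m|n m1 m2|n r m].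
- rewrite -raddfD; apply/eqP; rewrite -Quotient.idealrBE.
  by apply/asboolP; exact: tensor_rel_addl.
- rewrite -raddfD; apply/eqP; rewrite -Quotient.idealrBE.
  by apply/asboolP; exact: tensor_rel_addr.
- apply/eqP; rewrite -Quotient.idealrBE.
  by apply/asboolP; exact: tensor_rel_bal.
Qed.

Section Lift.
Variables (V : zmodType) (b : N -> M -> V).
Hypothesis b_bal : balanced b.

Let fb := fglift (fun p : N * M => b p.1 p.2 : zmodule V).

Let fbB x y : fb (x - y) = fb x - fb y.
Proof. exact: lift_is_additive. Qed.

Let fb0 : fb 0 = 0.
Proof. by rewrite -(subrr 0) fbB subrr. Qed.

Let fbD x y : fb (x + y) = fb x + fb y.
Proof. by rewrite -[y in LHS]opprK -[- y]add0r !fbB fb0 sub0r opprK. Qed.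

Let fbU p : fb << p >> = b p.1 p.2.
Proof. by rewrite /fb liftU scale1r. Qed.

Let fb_rel x : tensor_rel x -> fb x = 0.
Proof.
case: b_bal => bDl bDr bal.
elim=> [|{}x y _ x0 _ y0|n1 n2 m|n m1 m2|n r m].
- exact: fb0.
- by rewrite fbB x0 y0 subrr.
- by rewrite fbB fbD !fbU /= bDl subrr.
- by rewrite fbB fbD !fbU /= bDr subrr.
- by rewrite fbB !fbU /= bal subrr.
Qed.

Let lift_pi x : tensor_lift b (\pi_(Quotient.quot tensor_relb) x) = fb x.
Proof.
rewrite /tensor_lift -/fb; apply/eqP; rewrite -subr_eq0 -fbB; apply/eqP.
apply: fb_rel; apply/asboolP.
have : repr (\pi_(Quotient.quot tensor_relb) x) ==
       x %[mod Quotient.quot tensor_relb] by rewrite reprK.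
by rewrite -Quotient.idealrBE.
Qed.

Lemma tensor_liftE n m : tensor_lift b (tens n m) = b n m.
Proof. by rewrite lift_pi fbU. Qed.

Lemma tensor_liftD : {morph tensor_lift b : x y / x + y}.
Proof.
move=> x y; rewrite -[x](@reprK _ (Quotient.quot tensor_relb)).
rewrite -[y](@reprK _ (Quotient.quot tensor_relb)) -[_ + _]raddfD.
by rewrite !lift_pi fbD.
Qed.

Lemma tensor_lift_uniq (h : tensor -> V) :
  {morph h : x y / x + y} -> (forall n m, h (tens n m) = b n m) ->
  h =1 tensor_lift b.
Proof.
move=> hD hE x.
rewrite -[x](@reprK _ (Quotient.quot tensor_relb)) lift_pi.
set y := repr _; pose k z := h (\pi_(Quotient.quot tensor_relb) z).
have kD : {morph k : u v / u + v} by move=> u v; rewrite /k raddfD hD.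
have k0 : k 0 = 0 by apply: (addrI (k 0)); rewrite -kD !addr0.
have kN u : k (- u) = - k u.
  by apply: (addrI (k u)); rewrite -kD !subrr k0.
have fbN u : fb (- u) = - fb u by rewrite -sub0r fbB fb0 sub0r.
suff kE z : k z = fb z by exact: kE.
rewrite -(freeg_sumE z).
apply: (big_ind (fun w => k w = fb w)) => [|u v hu hv|p _].
- by rewrite k0 fb0.
- by rewrite kD fbD hu hv.
rewrite -[coeff p z]intz -freegU_mulz; set u : {freeg (N * M)%type} := << p >>.
have kfbu : k u = fb u by rewrite /k /u fbU -hE; case: (p).
have kfbMn n : k (u *+ n) = fb (u *+ n).
  by elim: n => [|n IHn]; rewrite ?mulr0n ?k0 ?fb0// mulrS kD fbD kfbu IHn.
case: (coeff p z) => n; first by rewrite -pmulrn kfbMn.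
by rewrite NegzE mulrNz -pmulrn kN fbN kfbMn.
Qed.

End Lift.
End TensorProduct.

Definition tensor_map (R : pzRingType) (N : lmodType R^c) (M M' : lmodType R)
    (f : {linear M -> M'}) : tensor N M -> tensor N M' :=
  tensor_lift (fun n m => tens n (f m)).

Lemma tensor_mapE (R : pzRingType) (N : lmodType R^c) (M M' : lmodType R)
    (f : {linear M -> M'}) (n : N) (m : M) :
  tensor_map f (tens n m) = tens n (f m).
Proof.
apply: (@tensor_liftE _ _ _ _ (fun n m => tens n (f m))).
have [tDl tDr tbal] := tens_balanced N M'.
by split=> *; rewrite ?tDl ?linearD ?tDr ?linearZ ?tbal.
Qed.

Definition short_exact (A B C : zmodType) (f : A -> B) (g : B -> C) : Prop :=
  [/\ injective f,
      forall b, g b = 0 <-> exists a, f a = b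
    & forall c, exists b, g b = c].

Definition pure_exact (R : pzRingType) (M' M M'' : lmodType R)
    (f : {linear M' -> M}) (g : {linear M -> M''}) : Prop :=
  short_exact f g /\
  forall N : lmodType R^c,
    short_exact (tensor_map (N := N) f) (tensor_map (N := N) g).

Definition pure_quotient (R : pzRingType) (M M'' : lmodType R) :=
  exists (M' : lmodType R) (f : {linear M' -> M}) (g : {linear M -> M''}),
    pure_exact f g.

Section DirectSum.
Variables (R : pzRingType) (I : Type) (M : I -> lmodType R).

Definition direct_product : Type := forall i, M i.

HB.instance Definition _ := Choice.on direct_product.

Section Operations.
Implicit Types (x y z : direct_product) (a b : R).

Definition dp_zero : direct_product := fun=> 0.
Definition dp_opp x : direct_product := fun i => - x i.
Definition dp_add x y : direct_product := fun i => x i + y i.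
Definition dp_scale a x : direct_product := fun i => a *: x i.

Fact dp_addA : associative dp_add.
Proof. by move=> x y z; apply: functional_extensionality_dep => i; apply: addrA. Qed.
Fact dp_addC : commutative dp_add.
Proof. by move=> x y; apply: functional_extensionality_dep => i; apply: addrC. Qed.
Fact dp_add0 : left_id dp_zero dp_add.
Proof. by move=> x; apply: functional_extensionality_dep => i; apply: add0r. Qed.
Fact dp_addN : left_inverse dp_zero dp_opp dp_add.
Proof. by move=> x; apply: functional_extensionality_dep => i; apply: addNr. Qed.

HB.instance Definition _ :=
  GRing.isZmodule.Build direct_product dp_addA dp_addC dp_add0 dp_addN.

Fact dp_scaleA a b x : dp_scale a (dp_scale b x) = dp_scale (a * b) x.
Proof. by apply: functional_extensionality_dep => i; apply: scalerA. Qed.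
Fact dp_scale1 : left_id 1 dp_scale.
Proof. by move=> x; apply: functional_extensionality_dep => i; apply: scale1r. Qed.
Fact dp_scaleDr : right_distributive dp_scale +%R.
Proof.
by move=> a x y; apply: functional_extensionality_dep => i; apply: scalerDr.
Qed.
Fact dp_scaleDl x : {morph dp_scale^~ x : a b / a + b}.
Proof.
by move=> a b; apply: functional_extensionality_dep => i; apply: scalerDl.
Qed.

HB.instance Definition _ := GRing.Zmodule_isLmodule.Build R direct_product
  dp_scaleA dp_scale1 dp_scaleDr dp_scaleDl.

End Operations.

Definition finsupp_pred : {pred direct_product} :=
  fun x => `[< finite_set [set i | x i <> 0] >].

Fact finsupp_closed : submod_closed finsupp_pred.
Proof.
split=> [|a x y /asboolP fx /asboolP fy]; apply/asboolP.
  by apply: (sub_finite_set _ (finite_set0 _)) => i /=; exact.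
have fxy : finite_set ([set i | x i <> 0] `|` [set i | y i <> 0])%classic.
  by rewrite finite_setU.
apply: sub_finite_set fxy => i /= xyi.
have [xi0|] := eqVneq (x i) 0; last by move/eqP; left.
right=> yi0; apply: xyi.
by rewrite -[LHS]/(a *: x i + y i) xi0 yi0 scaler0 addr0.
Qed.

HB.instance Definition _ :=
  GRing.isSubmodClosed.Build R direct_product finsupp_pred finsupp_closed.

Record direct_sum : Type := DirectSum {
  direct_sum_val : direct_product;
  _ : direct_sum_val \in finsupp_pred
}.

HB.instance Definition _ := [isSub for direct_sum_val].
HB.instance Definition _ := [Choice of direct_sum by <:].
HB.instance Definition _ := [SubChoice_isSubLmodule of direct_sum by <:].

End DirectSum.

Section ModuleClasses.
Variables (R : pzRingType) (F : lmodType R -> Prop).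

Definition closed_iso :=
  forall (M M' : lmodType R) (f : {linear M -> M'}),
    bijective f -> F M -> F M'.

Definition closed_pure_quotient :=
  forall M M'' : lmodType R, pure_quotient M M'' -> F M -> F M''.

(* [I] may be empty, so this includes [F] of the zero module.                  *)
Definition closed_direct_sum :=
  forall (I : Type) (M : I -> lmodType R),
    (forall i, F (M i)) -> F (direct_sum M).

Definition is_precover (M X : lmodType R) (p : {linear X -> M}) : Prop :=
  F X /\
  forall (X' : lmodType R) (q : {linear X' -> M}), F X' ->
    exists h : {linear X' -> X}, p \o h =1 q.

Definition is_cover (M X : lmodType R) (p : {linear X -> M}) : Prop :=
  is_precover p /\
  forall h : {linear X -> X}, p \o h =1 p -> bijective h.

Definition precovering :=
  forall M : lmodType R, exists (X : lmodType R) (p : {linear X -> M}),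
    is_precover p.

Definition covering :=
  forall M : lmodType R, exists (X : lmodType R) (p : {linear X -> M}),
    is_cover p.

End ModuleClasses.

(* Main.v *)
From HB Require Import structures.
Require Import Defs.
From mathcomp Require Import all_boot all_algebra.
From mathcomp Require Import boolp classical_sets cardinality.
From mathcomp.multinomials Require Import freeg.

Set Implicit Arguments.
Unset Strict Implicit.
Unset Printing Implicit Defensive.

Import GRing.Theory.
Local Open Scope ring_scope.
Local Open Scope quotient_scope.

(** Two kinds of pure quotients carry the theorem: small quotients of a module in
    [F] over a given module [M], and directed colimits of modules in [F].

    Purity is handled through local retractions: a submodule [P] of [A] is pure
    as soon as, for every finite part of [A], some map [A -> P] fixes the
    elements of [P] in that part and respects the sums and scalar products
    formed inside it.  A formal proof that an element of [N (x) A] vanishes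
    only mentions finitely many elements of [A], so it can be transported along
    such a map to [N (x) P] ([pure_submodule_tensor_inj]).

    Sums give precovers ([direct_sum_precovering]).  Let [q : X -> M] with [X]
    in [F].  By Zorn's lemma, dividing [X] by a maximal pure submodule of
    [ker q] yields a pure quotient [C], still in [F], through which [q] factors,
    such that the kernel of [C -> M] contains no nonzero pure submodule
    ([pure_reduction]).  Such a [C] is bounded in size by [R] and [M] alone: a
    Skolem hull [B] of [C], closed under realising every small pattern of linear
    relations with prescribed images in [M], is the image of a fixed inductive
    type of codes, and an element [c] outside [B] would produce a nonzero pure
    submodule of the kernel ([reduced_decoded]).  That submodule is
    [{x - gamma x}], where [x] runs over a small hull [S] of [c] and
    [gamma : S -> B] is a copy of [S] inside [B] that fixes [S] meet [B] and
    agrees with the identity over [M]: it is the kernel of a retraction of the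
    pure submodule [S + B] onto [B].  So all maps from [F] to [M] factor through
    a set of maps, and the direct sum of their sources is a precover.

    Precovers give sums ([precovering_direct_sum]): if [X -> M] is a precover
    of a direct sum [M] of modules in [F], the inclusions of the summands lift
    to [X], so [X -> M] splits, and split epimorphisms are pure.

    Precovers give covers ([cover_of_precover]).  A directed colimit is a pure
    quotient of a direct sum, its kernel being a directed union of direct
    summands, so [F] is closed under directed colimits
    ([directed_colimit_exists]).  Hence every chain of endomorphisms of a
    precover over [M] has a cocone of the same kind ([chain_cocone]), and
    chains can be prolonged at will by Zorn's lemma ([chain_exists]).  A chain
    with strictly growing kernels, or with no transition map onto, indexed by the double
    powerset of [X], contradicts Cantor's theorem.  The first contradiction
    gives an endomorphism [e] whose kernel no further endomorphism enlarges;
    on the colimit of [X -e-> X -e-> ...] all endomorphisms over [M] are then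
    injective, and the second contradiction makes them surjective. *)

(** * Submodules and quotients *)

Lemma linear_map_of (R : pzRingType) (A B : lmodType R) (f : A -> B) :
  linear f -> exists g : {linear A -> B}, g =1 f.
Proof.
move=> fl; pose m := GRing.isLinear.Build R A B *:%R f fl.
pose g : {linear A -> B} := HB.pack f m.
by exists g.
Qed.

Section Submodules.
Variables (R : pzRingType) (A : lmodType R).

Definition submodule (P : A -> Prop) :=
  P 0 /\ forall (a : R) x y, P x -> P y -> P (a *: x + y).

Section Pred.
Variables (P : A -> Prop) (Psub : submodule P).

Definition submodule_pred of submodule P : {pred A} := fun x => `[< P x >].

Fact submodule_pred_closed : submod_closed (submodule_pred Psub).
Proof.
case: (Psub) => P0 PD; split=> [|a x y /asboolP Px /asboolP Py]; apply/asboolP.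
  exact: P0.
exact: PD.
Qed.

HB.instance Definition _ :=
  GRing.isSubmodClosed.Build R A (submodule_pred Psub) submodule_pred_closed.

Record submodule_type := SubmoduleElt {
  submodule_val : A;
  _ : submodule_val \in submodule_pred Psub
}.

HB.instance Definition _ := [isSub for submodule_val].
HB.instance Definition _ := [Choice of submodule_type by <:].
HB.instance Definition _ := [SubChoice_isSubLmodule of submodule_type by <:].

Lemma submodule_inclusion : exists (B : lmodType R) (f : {linear B -> A}),
  injective f /\ forall a, P a <-> exists b, f b = a.
Proof.
exists submodule_type, (\val : {linear submodule_type -> A}).
split=> [|a]; first exact: val_inj.
split=> [Pa|[[b /asboolP Pb] /= <-//]].
have aP : a \in submodule_pred Psub by apply/asboolP.
by exists (SubmoduleElt aP).
Qed.

Definition module_quotient : Type := Quotient.quot (submodule_pred Psub).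
HB.instance Definition _ := GRing.Zmodule.on module_quotient.

Let pi (x : A) : module_quotient :=
  \pi_(Quotient.quot (submodule_pred Psub)) x.

Let rp (x : module_quotient) : A :=
  repr (x : Quotient.quot (submodule_pred Psub)).

Let piK x : pi (rp x) = x.
Proof. exact: (@reprK _ (Quotient.quot (submodule_pred Psub))). Qed.

Let pi_eq x y : pi x = pi y <-> P (x - y).
Proof.
rewrite /pi; split=> [/eqP|Pxy]; last apply/eqP.
  by rewrite -Quotient.idealrBE => /asboolP.
by rewrite -Quotient.idealrBE; apply/asboolP.
Qed.

Let piD x y : pi (x + y) = pi x + pi y.
Proof. by rewrite /pi raddfD. Qed.

Definition mq_scale (a : R) (x : module_quotient) : module_quotient :=
  pi (a *: rp x).

Let scale_pi a x : mq_scale a (pi x) = pi (a *: x).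
Proof.
apply/pi_eq; rewrite -scalerBr -[_ *: _]addr0.
case: (Psub) => P0 PD; apply: PD => //.
by apply/pi_eq; rewrite piK.
Qed.

Fact mq_scaleA a b x : mq_scale a (mq_scale b x) = mq_scale (a * b) x.
Proof. by rewrite -[x]piK !scale_pi scalerA. Qed.
Fact mq_scale1 : left_id 1 mq_scale.
Proof. by move=> x; rewrite -[x]piK scale_pi scale1r. Qed.
Fact mq_scaleDr : right_distributive mq_scale +%R.
Proof. by move=> a x y; rewrite -[x]piK -[y]piK -piD !scale_pi scalerDr piD. Qed.
Fact mq_scaleDl x : {morph mq_scale^~ x : a b / a + b}.
Proof. by move=> a b; rewrite -[x]piK !scale_pi scalerDl piD. Qed.

HB.instance Definition _ := GRing.Zmodule_isLmodule.Build R module_quotient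
  mq_scaleA mq_scale1 mq_scaleDr mq_scaleDl.

Lemma quotient_map : exists g : {linear A -> module_quotient},
  (forall c, exists a, g a = c) /\ forall a, g a = 0 <-> P a.
Proof.
have [|g gE] := @linear_map_of _ _ _ pi.
  by move=> a x y; rewrite piD -scale_pi.
exists g; split=> [c|a]; first by exists (rp c); rewrite gE piK.
have pi0 : pi 0 = 0 by rewrite /pi raddf0.
by rewrite gE -pi0 pi_eq subr0.
Qed.

End Pred.

Lemma submoduleD P x y : submodule P -> P x -> P y -> P (x + y).
Proof. by case=> _ PD Px Py; rewrite -[x]scale1r; apply: PD. Qed.

Lemma submoduleZ P a x : submodule P -> P x -> P (a *: x).
Proof. by case=> P0 PD Px; rewrite -[_ *: _]addr0; apply: PD. Qed.

Lemma submoduleN P x : submodule P -> P x -> P (- x).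
Proof. by move=> Ps Px; rewrite -scaleN1r; apply: submoduleZ. Qed.

Lemma submoduleB P x y : submodule P -> P x -> P y -> P (x - y).
Proof. by move=> Ps Px Py; apply: submoduleD => //; apply: submoduleN. Qed.

End Submodules.

Lemma kernel_submodule (R : pzRingType) (A C : lmodType R)
    (g : {linear A -> C}) : submodule (fun a => g a = 0).
Proof.
split=> [|a x y gx gy]; first exact: linear0.
by rewrite linearP gx gy scaler0 addr0.
Qed.

Lemma factor_through_surjection (R : pzRingType) (A C Y : lmodType R)
    (g : {linear A -> C}) (f : {linear A -> Y}) :
  (forall c, exists a, g a = c) -> (forall a, g a = 0 -> f a = 0) ->
  exists h : {linear C -> Y}, forall a, h (g a) = f a.
Proof.
move=> /choice[s gs] gf.
have fs a : f (s (g a)) = f a.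
  by apply/eqP; rewrite -subr_eq0 -linearB gf // linearB gs subrr.
have [|h hE] := @linear_map_of _ _ _ (f \o s).
  by move=> a x y; rewrite /= -linearP -[RHS]fs linearP !gs.
by exists h => a; rewrite hE /= fs.
Qed.

(** * Right exactness of the tensor product *)

Section Tensor.
Variables (R : pzRingType) (N : lmodType R^c).

(** Every tensor is a signed sum of pure tensors, so additive facts need only be
    checked on these. *)
Lemma tensor_ind (M : lmodType R) (P : tensor N M -> Prop) :
  P 0 -> (forall x y, P x -> P y -> P (x - y)) ->
  (forall n m, P (tens n m)) -> forall t, P t.
Proof.
move=> P0 PB Pt t.
have PN x : P x -> P (- x) by rewrite -sub0r; apply: PB.
have PD x y : P x -> P y -> P (x + y).
  by move=> Px Py; rewrite -[y]opprK; apply: PB => //; apply: PN.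
rewrite -[t](@reprK _ (Quotient.quot (tensor_relb (N := N) (M := M)))).
rewrite -(freeg_sumE (repr _)) raddf_sum.
apply: (big_ind P) => // -[n m] _.
rewrite -[coeff _ _]intz -freegU_mulz.
have PMn k : P (tens n m *+ k).
  by elim: k => [|k IHk]; rewrite ?mulr0n // mulrS; apply: PD.
by case: (coeff _ _) => k; rewrite ?NegzE ?mulrNz -?pmulrn ?raddfN raddfMn //;
   apply: PN.
Qed.

Lemma tens0r (M : lmodType R) (n : N) : tens n (0 : M) = 0.
Proof.
have [_ tDr _] := tens_balanced N M.
by apply: (addrI (tens n 0)); rewrite -tDr !addr0.
Qed.

Lemma tensNr (M : lmodType R) (n : N) (m : M) : tens n (- m) = - tens n m.
Proof.
have [_ tDr _] := tens_balanced N M.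
by apply: (addrI (tens n m)); rewrite -tDr !subrr tens0r.
Qed.

Lemma tensBr (M : lmodType R) (n : N) (m m' : M) :
  tens n (m - m') = tens n m - tens n m'.
Proof. by have [_ tDr _] := tens_balanced N M; rewrite tDr tensNr. Qed.

Section Map.
Variables (M M' : lmodType R) (f : {linear M -> M'}).

Lemma tensor_mapD : {morph tensor_map (N := N) f : x y / x + y}.
Proof.
have [tDl tDr tbal] := tens_balanced N M'.
by apply: tensor_liftD; split=> *; rewrite ?tDl ?linearD ?tDr ?linearZ ?tbal.
Qed.

Lemma tensor_map0 : tensor_map (N := N) f 0 = 0.
Proof.
by apply: (addrI (tensor_map (N := N) f 0)); rewrite -tensor_mapD !addr0.
Qed.

Lemma tensor_mapB x y :
  tensor_map (N := N) f (x - y) = tensor_map f x - tensor_map f y.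
Proof. by apply: (addIr (tensor_map f y)); rewrite -tensor_mapD !subrK. Qed.

End Map.

Section RightExact.
Variables (A B C : lmodType R) (f : {linear A -> B}) (g : {linear B -> C}).
Hypothesis gsurj : forall c, exists b, g b = c.
Hypothesis ker_g : forall b, g b = 0 <-> exists a, f a = b.

Lemma tensor_map_surj t : exists s, tensor_map (N := N) g s = t.
Proof.
move: t; apply: tensor_ind => [|x y [s sx] [s' sy]|n c].
- by exists 0; exact: tensor_map0.
- by exists (s - s'); rewrite tensor_mapB sx sy.
- by have [b <-] := gsurj c; exists (tens n b); rewrite tensor_mapE.
Qed.

Let tensor_map_image : {pred tensor N B} :=
  fun t => `[< exists s, tensor_map (N := N) f s = t >].

Fact tensor_map_image_closed : zmod_closed tensor_map_image.
Proof.
split=> [|x y /asboolP[s sx] /asboolP[s' sy]]; apply/asboolP.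
  by exists 0; exact: tensor_map0.
by exists (s - s'); rewrite tensor_mapB sx sy.
Qed.

(** The inverse of the map induced by [N (x) g] on the cokernel of [N (x) f]
    sends the class of [n (x) c] to that of [n (x) b] for any [b] over [c]. *)
Lemma tensor_map_exact t : tensor_map (N := N) g t = 0 <->
  exists s, tensor_map (N := N) f s = t.
Proof.
split=> [gt0|[s <-]]; last first.
  move: s; apply: tensor_ind => [|x y x0 y0|n a].
  - by rewrite !tensor_map0.
  - by rewrite !tensor_mapB x0 y0 subrr.
  - rewrite !tensor_mapE (_ : g _ = 0) ?tens0r //; apply/ker_g; by exists a.
pose m := GRing.isZmodClosed.Build _ tensor_map_image tensor_map_image_closed.
pose I : zmodClosed (tensor N B) := HB.pack tensor_map_image m.
have [s sg] := choice gsurj.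
pose b (n : N) (c : C) : Quotient.quot I :=
  \pi_(Quotient.quot I) (tens n (s c) : tensor N B).
have imE x y : (exists s, tensor_map (N := N) f s = x - y) ->
    \pi_(Quotient.quot I) x = \pi_(Quotient.quot I) y.
  by move=> xy; apply/eqP; rewrite -Quotient.idealrBE; apply/asboolP.
have imt n x y : g x = g y -> \pi_(Quotient.quot I) (tens n x) =
    \pi_(Quotient.quot I) (tens n y).
  move=> gxy; apply: imE; rewrite -tensBr.
  have /ker_g[a <-] : g (x - y) = 0 by rewrite linearB gxy subrr.
  by exists (tens n a); rewrite tensor_mapE.
have [tDl tDr tbal] := tens_balanced N B.
have bbal : balanced b.
  split=> [n1 n2 c|n c1 c2|n r c]; rewrite /b.
  - by rewrite tDl raddfD.
  - by rewrite -raddfD -tDr; apply: imt; rewrite linearD !sg.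
  - by rewrite tbal; apply: imt; rewrite linearZ !sg.
have bg u : tensor_lift b (tensor_map g u) = \pi_(Quotient.quot I) u.
  have bD := tensor_liftD bbal.
  have b0 : tensor_lift b 0 = 0.
    by apply: (addrI (tensor_lift b 0)); rewrite -bD !addr0.
  have bB x y : tensor_lift b (x - y) = tensor_lift b x - tensor_lift b y.
    by apply: (addIr (tensor_lift b y)); rewrite -bD !subrK.
  move: u; apply: tensor_ind => [|x y x0 y0|n a].
  - by rewrite tensor_map0 b0 raddf0.
  - by rewrite tensor_mapB bB x0 y0 raddfB.
  - by rewrite tensor_mapE tensor_liftE //; apply: imt; rewrite sg.
have /eqP : \pi_(Quotient.quot I) t = \pi_(Quotient.quot I) 0.
  rewrite -bg gt0 raddf0; have bD := tensor_liftD bbal.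
  by apply: (addrI (tensor_lift b 0)); rewrite -bD !addr0.
by rewrite -Quotient.idealrBE subr0 => /asboolP.
Qed.

End RightExact.
End Tensor.

(** * Purity by local retractions *)

(** Solvability in [P] of the finite linear systems with parameters in [P] that are
    solvable in [A]: a finite part [s], [rs] of [A] and [R] is such a system
    together with a solution, and [rho] moves the solution into [P]. *)
Definition pure_submodule (R : pzRingType) (A : lmodType R) (P : A -> Prop) :=
  forall (s : seq A) (rs : seq R), exists rho : A -> A,
    [/\ forall a, P (rho a),
        forall a, a \in s -> P a -> rho a = a,
        {in s &, {morph rho : a b / a + b}}
      & forall r a, r \in rs -> a \in s -> rho (r *: a) = r *: rho a].

Section PureQuotient.
Variables (R : pzRingType).

(* The additive extension of [(n, a) |-> n (x) rho a] to formal sums, for a map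
   [rho] that need not be linear. *)
Let ext (N : lmodType R^c) (A B : lmodType R) (rho : A -> B)
    (x : {freeg (N * A)%type}) : tensor N B :=
  fglift (fun p => tens p.1 (rho p.2) : zmodule (tensor N B)) x.

Let extB (N : lmodType R^c) (A B : lmodType R) (rho : A -> B) x y :
  ext (N := N) rho (x - y) = ext rho x - ext rho y.
Proof.
exact: (@lift_is_additive _ _ _ (fun p => tens p.1 (rho p.2) : zmodule (tensor N B))).
Qed.

Let ext0 (N : lmodType R^c) (A B : lmodType R) (rho : A -> B) :
  ext (N := N) rho 0 = 0.
Proof. by rewrite -(subrr 0) extB subrr. Qed.

Let extD (N : lmodType R^c) (A B : lmodType R) (rho : A -> B) x y :
  ext (N := N) rho (x + y) = ext rho x + ext rho y.
Proof. by rewrite -[y in LHS]opprK -[- y]add0r !extB ext0 sub0r opprK. Qed.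

Let extU (N : lmodType R^c) (A B : lmodType R) (rho : A -> B) n a :
  ext (N := N) rho << (n, a) >> = tens n (rho a).
Proof. by rewrite /ext liftU scale1r. Qed.

(* A derivation of [x = 0] in the tensor product is finite, so it survives along any
   [rho] that respects the few relations it invokes. *)
Let ext_rel (N : lmodType R^c) (A B : lmodType R) (x : {freeg (N * A)%type}) :
  tensor_rel x -> exists (s : seq A) (rs : seq R), forall rho : A -> B,
    {in s &, {morph rho : a b / a + b}} ->
    (forall r a, r \in rs -> a \in s -> rho (r *: a) = r *: rho a) ->
    ext rho x = 0.
Proof.
have [tDl tDr tbal] := tens_balanced N B.
elim=> {x} [|x y _ [s [rs xE]] _ [s' [rs' yE]]|n1 n2 a|n a b|n r a].
- by exists [::], [::] => rho _ _; exact: ext0.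
- exists (s ++ s'), (rs ++ rs') => rho rhoD rhoZ.
  rewrite extB xE ?yE ?subrr //.
  + by move=> u v us vs; apply: rhoD; rewrite mem_cat ?us ?vs orbT.
  + by move=> q u qs us; apply: rhoZ; rewrite mem_cat ?qs ?us orbT.
  + by move=> u v us vs; apply: rhoD; rewrite mem_cat ?us ?vs.
  + by move=> q u qs us; apply: rhoZ; rewrite mem_cat ?qs ?us.
- by exists [::], [::] => rho _ _; rewrite extB extD !extU tDl subrr.
- exists [:: a; b], [::] => rho rhoD _.
  by rewrite extB extD !extU rhoD ?tDr ?subrr // !inE eqxx ?orbT.
- exists [:: a], [:: r] => rho _ rhoZ.
  by rewrite extB !extU rhoZ ?tbal ?subrr // inE.
Qed.

(** If the image of [t] in [N (x) A] vanishes, replaying the derivation of this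
    along a local retraction onto [B] shows that [t] vanishes. *)
Lemma pure_submodule_tensor_inj (N : lmodType R^c) (A B : lmodType R)
    (f : {linear B -> A}) (P : A -> Prop) :
  injective f -> (forall a, P a <-> exists b, f b = a) ->
  pure_submodule P -> injective (tensor_map (N := N) f).
Proof.
move=> finj imf Ppure t u tu; apply/eqP; rewrite -subr_eq0; apply/eqP.
have : tensor_map f (t - u) = 0 by rewrite tensor_mapB tu subrr.
move: (t - u) => {tu} {}t {u} ft0.
(* [t] is recovered from a formal sum representing its image. *)
have [x [s [xt xE]]] : exists (x : {freeg (N * A)%type}) (s : seq B),
    \pi_(Quotient.quot (tensor_relb (N := N) (M := A))) x = tensor_map f t /\
    forall rho : A -> B, (forall b, b \in s -> rho (f b) = b) -> ext rho x = t.
  move: t {ft0}; apply: tensor_ind => [|t u [x [s [xt xE]]] [y [s' [yu yE]]]|n b].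
  - by exists 0, [::]; rewrite raddf0 tensor_map0; split=> // rho _; exact: ext0.
  - exists (x - y), (s ++ s'); rewrite tensor_mapB -xt -yu -raddfB; split=> // rho h.
    rewrite extB xE ?yE // => b bs; apply: h; rewrite mem_cat bs ?orbT //.
  - exists << (n, f b) >>, [:: b]; rewrite tensor_mapE; split=> // rho h.
    by rewrite extU h // inE.
have /(ext_rel B)[r [rs x0]] : tensor_rel x.
  apply/asboolP; rewrite -[x]subr0.
  change (x - 0 \in tensor_relb (N := N) (M := A)).
  by rewrite Quotient.idealrBE; apply/eqP; rewrite xt ft0 raddf0.
have [rho [rhoP rho_id rhoD rhoZ]] := Ppure (map f s ++ r) rs.
have /choice[rho' rho'E] : forall a, exists b, f b = rho a by move=> a; apply/imf.
rewrite -(xE rho') ?x0 //.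
- by move=> a b aS bS; apply: finj; rewrite linearD !rho'E rhoD // mem_cat ?aS ?bS orbT.
- by move=> q a rS aS; apply: finj; rewrite linearZ !rho'E rhoZ // mem_cat aS orbT.
- move=> b bs; apply: finj; rewrite rho'E rho_id //; last by apply/imf; exists b.
  by rewrite mem_cat map_f.
Qed.

Lemma pure_kernel_quotient (A C : lmodType R) (g : {linear A -> C}) :
  (forall c, exists a, g a = c) -> pure_submodule (fun a => g a = 0) ->
  pure_quotient A C.
Proof.
move=> gsurj kpure.
have [B [f [finj fE]]] := submodule_inclusion (kernel_submodule g).
exists B, f, g; split=> [|N]; split=> //.
- exact: pure_submodule_tensor_inj kpure.
- by move=> t; apply: tensor_map_exact.
- by move=> t; apply: tensor_map_surj.
Qed.

End PureQuotient.

(** * Chains of pure submodules and reduction of maps *)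

Section PureSubmodules.
Variables (R : pzRingType) (A : lmodType R).

(** The kernels of split epimorphisms and of maps to directed colimits are pure
    for this reason: a linear retraction is available on each finite part. *)
Lemma locally_split_pure (P : A -> Prop) :
  (forall s : seq A, exists rho : {linear A -> A},
    (forall a, P (rho a)) /\ forall a, a \in s -> P a -> rho a = a) ->
  pure_submodule P.
Proof.
move=> Psplit s rs; have [rho [rhoP rho_id]] := Psplit s.
by exists rho; split=> // [a b _ _|r a _ _]; rewrite ?linearD ?linearZ.
Qed.

Definition pure_submodule_in (K P : A -> Prop) :=
  [/\ submodule P, pure_submodule P & forall a, P a -> K a].

(** A finite part of the union is captured by one member of the chain, whose local
    retractions serve for the union. *)
Lemma pure_chain_union (K : A -> Prop) (S : set (set A)) :
  (S !=set0)%classic -> total_on S subset -> (forall P, S P -> pure_submodule_in K P) ->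
  pure_submodule_in K (fun a => exists2 P, S P & P a).
Proof.
move=> [P0 SP0] Stot Sgood.
have capture (s : seq A) : exists2 P, S P &
    forall a, a \in s -> (exists2 Q, S Q & Q a) -> P a.
  elim: s => [|a s [P SP Ps]]; first by exists P0.
  have [[Q SQ Qa]|nQ] := pselect (exists2 Q, S Q & Q a); last first.
    exists P => // b; rewrite inE => /predU1P[->|bs]; last exact: Ps.
    by move/nQ.
  have [PQ|QP] := Stot _ _ SP SQ.
    exists Q => // b; rewrite inE => /predU1P[-> //|bs Sb].
    exact/PQ/Ps.
  exists P => // b; rewrite inE => /predU1P[->|bs]; last exact: Ps.
  by move=> _; apply: QP.
split=> [|s rs|a [P /Sgood[_ _ PK] /PK]//].
  split=> [|r x y [P SP Px] [Q SQ Qy]].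
    by exists P0 => //; have [[]] := Sgood _ SP0.
  have [P' SP' P'xy] := capture [:: x; y].
  exists P' => //; have [[_ P'D] _ _] := Sgood _ SP'.
  by apply: P'D; apply: P'xy; rewrite ?inE ?eqxx ?orbT //;
     [exists P | exists Q].
have [P SP Ps] := capture s; have [_ Ppure _] := Sgood _ SP.
have [rho [rhoP rho_id rhoD rhoZ]] := Ppure s rs.
exists rho; split=> // [a|a as_ aS]; first by exists P.
by apply: rho_id => //; apply: Ps.
Qed.

(** Zorn's lemma is applied to sets [X] whose union with [{0}] is a pure submodule
    contained in [K], because the union of the empty chain is the empty set. *)
Lemma maximal_pure_submodule (K : A -> Prop) : K 0 ->
  exists2 P, pure_submodule_in K P &
    forall P', pure_submodule_in K P' -> (forall a, P a -> P' a) ->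
      forall a, P' a -> P a.
Proof.
move=> K0; pose add0 (X : set A) : set A := fun a => X a \/ a = 0.
have good0 : pure_submodule_in K (fun a => a = 0).
  split=> [|s rs|a -> //].
    by split=> // r x y -> ->; rewrite scaler0 addr0.
  by exists (fun=> 0); split=> // [a b _ _|r a _ _]; rewrite ?addr0 ?scaler0.
have [F FG Ftot|X [/= Xgood Xmax]] :=
    @Zorn_bigcup A [set X | pure_submodule_in K (add0 X)]%classic.
  pose S := [set Y | Y = (fun a => a = 0) \/ exists2 X, F X & Y = add0 X]%classic.
  rewrite /= (_ : add0 _ = fun a => exists2 P, S P & P a); last first.
    apply/funext => a; apply/propext; split.
      move=> [[X FX Xa]|->]; last by exists (fun a => a = 0); [left|].
      by exists (add0 X); [right; exists X|left].
    move=> [P [->|[X FX ->]]]; first by right.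
    by move=> [Xa|->]; [left; exists X|right].
  apply: pure_chain_union.
  - by exists (fun a => a = 0); left.
  - move=> Y Z [->|[X FX ->]] [->|[X' FX' ->]].
    + by left.
    + by left=> a ->; right.
    + by right=> a ->; right.
    + have [XX'|XX'] := Ftot _ _ FX FX'; [left|right].
        by move=> a [/XX'|->]; [left|right].
      by move=> a [/XX'|->]; [left|right].
  - by move=> P [->|[X /FG ? ->]].
exists (add0 X) => // P' P'good XP' a P'a.
apply: contrapT => nXa; apply: (Xmax P').
  by split; [move=> b Xb; apply: XP'; left|move=> /(_ _ P'a) Xa; apply: nXa; left].
rewrite /= (_ : add0 P' = P') //; apply/funext => b; apply/propext.
by split=> [[//|->]|]; [case: P'good => -[]|left].
Qed.

End PureSubmodules.

Section PureComposition.
Variables (R : pzRingType) (A C : lmodType R) (g : {linear A -> C}).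
Hypothesis gsurj : forall c, exists a, g a = c.

(** Purity is transitive.  A local retraction [sigma] onto [Q] lifts to a map [tau]
    that fails to respect relations only by elements of [ker g].  Since
    [w = a - tau a] has the opposite failures, adding [rho (w a)], with [rho] a local
    retraction onto [ker g], corrects [tau]. *)
Lemma pure_preimage (Q : C -> Prop) :
  pure_submodule (fun a => g a = 0) -> pure_submodule Q ->
  pure_submodule (fun a => Q (g a)).
Proof.
move=> kpure Qpure s rs.
have [sigma [sigmaQ sigma_id sigmaD sigmaZ]] := Qpure (map g s) rs.
have [lift liftE] := choice gsurj.
pose tau a := lift (sigma (g a)); pose w a := a - tau a.
have gtau a : g (tau a) = sigma (g a) by rewrite liftE.
pose d a b := tau (a + b) - (tau a + tau b).
pose e r a := tau (r *: a) - r *: tau a.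
have wD a b : w (a + b) = w a + w b - d a b.
  by rewrite /w /d addrACA -opprD opprB addrA addrNK.
have wZ r a : w (r *: a) = r *: w a - e r a.
  by rewrite /w /e scalerBr opprB addrA addrNK.
have kd a b : a \in s -> b \in s -> g (- d a b) = 0.
  move=> aS bS; rewrite linearN linearB linearD !gtau linearD sigmaD ?map_f //.
  by rewrite subrr oppr0.
have ke r a : r \in rs -> a \in s -> g (- e r a) = 0.
  move=> rS aS; rewrite linearN linearB linearZ !gtau linearZ sigmaZ ?map_f //.
  by rewrite subrr oppr0.
pose s2 := [seq w a + w b | a <- s, b <- s] ++ [seq - d a b | a <- s, b <- s].
pose s3 := [seq r *: w a | r <- rs, a <- s] ++ [seq - e r a | r <- rs, a <- s].
have [rho [rhoK rho_id rhoD rhoZ]] := kpure (map w s ++ s2 ++ s3) rs.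
have in1 a : a \in s -> w a \in map w s ++ s2 ++ s3.
  by move=> aS; rewrite mem_cat map_f.
exists (fun a => tau a + rho (w a)); split=> [a|a aS Qa|a b aS bS|r a rS aS].
- by rewrite linearD rhoK addr0 gtau.
- rewrite rho_id ?in1 //; first by rewrite /w addrC subrK.
  by rewrite linearB gtau sigma_id ?subrr // map_f.
- have in2 : w a + w b \in map w s ++ s2 ++ s3.
    rewrite !mem_cat; apply/orP; right; apply/orP; left; apply/orP; left.
    exact: (allpairs_f (fun a b => w a + w b)).
  have in3 : - d a b \in map w s ++ s2 ++ s3.
    rewrite !mem_cat; apply/orP; right; apply/orP; left; apply/orP; right.
    exact: (allpairs_f (fun a b => - d a b)).
  rewrite wD rhoD // (rhoD (w a)) ?in1 // (rho_id (- _)) ?kd //.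
  by rewrite /d opprB addrCA [X in _ + X]addrC subrK [RHS]addrACA addrC.
- have in2 : r *: w a \in map w s ++ s2 ++ s3.
    rewrite !mem_cat; apply/orP; right; apply/orP; right; apply/orP; left.
    exact: (allpairs_f (fun r a => r *: w a)).
  have in3 : - e r a \in map w s ++ s2 ++ s3.
    rewrite !mem_cat; apply/orP; right; apply/orP; right; apply/orP; right.
    exact: (allpairs_f (fun r a => - e r a)).
  rewrite wZ rhoD // rhoZ ?in1 // (rho_id (- _)) ?ke //.
  by rewrite /e opprB scalerDr addrCA [X in _ + X]addrC subrK addrC.
Qed.

End PureComposition.

(** Divide by a maximal pure submodule of [ker q]; by transitivity of purity nothing
    pure is left in the kernel. *)
Lemma pure_reduction (R : pzRingType) (A M : lmodType R) (q : {linear A -> M}) :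
  exists (C : lmodType R) (g : {linear A -> C}) (q' : {linear C -> M}),
  [/\ pure_quotient A C, forall a, q' (g a) = q a &
      forall Q, pure_submodule_in (fun c => q' c = 0) Q -> forall c, Q c -> c = 0].
Proof.
have [P [Psub Ppure PK] Pmax] :=
  @maximal_pure_submodule _ _ (fun a => q a = 0) (linear0 q).
have [g [gsurj gK]] := quotient_map Psub.
have [q' q'E] : exists h : {linear module_quotient Psub -> M},
    forall a, h (g a) = q a.
  by apply: factor_through_surjection => // a /gK /PK.
have kerE : (fun a => g a = 0) = P by apply/funext => a; apply/propext/gK.
exists (module_quotient Psub), g, q'; split=> //.
  by apply: pure_kernel_quotient gsurj _; rewrite kerE.
move=> Q [[Q0 QD] Qpure QK] c; have [a <-] := gsurj c => Qga.
apply/gK; apply: (Pmax (fun a => Q (g a))) => // [|b /gK ->]; last exact: Q0.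
split=> [||b /QK]; last by rewrite q'E.
  by split=> [|r x y Qx Qy]; rewrite ?linear0 // linearP; apply: QD.
by apply: pure_preimage; rewrite ?kerE.
Qed.

(** * Systems of linear relations in countably many unknowns *)

Section Relations.
Variable R : pzRingType.

(** A set of equations [v i + v j = v k] and [r *: v i = v j], given as data that
    mentions no module: this is what lets the codes below depend on [R] and [M]
    only. *)
Definition relations (V : Type) : Type :=
  ((V -> V -> V -> Prop) * (R -> V -> V -> Prop))%type.

Definition solves (V : Type) (A : lmodType R) (E : relations V) (v : V -> A) :=
  (forall i j k, E.1 i j k -> v i + v j = v k) /\
  (forall r i j, E.2 r i j -> r *: v i = v j).

Definition relations_of (V : Type) (A : lmodType R) (v : V -> A) : relations V :=
  (fun i j k => v i + v j = v k, fun r i j => r *: v i = v j).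

Lemma solves_relations_of V (A : lmodType R) (v : V -> A) :
  solves (relations_of v) v.
Proof. by []. Qed.

Lemma solves_trans V (A B : lmodType R) E (v : V -> A) (w : V -> B) :
  solves E v -> solves (relations_of v) w -> solves E w.
Proof.
move=> [vD vZ] [wD wZ]; split=> [i j k ijk|r i j ij].
  exact: (wD i j k (vD _ _ _ ijk)).
exact: (wZ r i j (vZ _ _ _ ij)).
Qed.

Lemma solvesD V (A : lmodType R) E (v w : V -> A) :
  solves E v -> solves E w -> solves E (fun i => v i + w i).
Proof.
move=> [vD vZ] [wD wZ]; split=> [i j k ijk|r i j ij].
  by rewrite addrACA (vD _ _ _ ijk) (wD _ _ _ ijk).
by rewrite scalerDr (vZ _ _ _ ij) (wZ _ _ _ ij).
Qed.

Lemma solvesN V (A : lmodType R) E (v : V -> A) :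
  solves E v -> solves E (fun i => - v i).
Proof.
move=> [vD vZ]; split=> [i j k ijk|r i j ij]; first by rewrite -opprD (vD _ _ _ ijk).
by rewrite scalerN (vZ _ _ _ ij).
Qed.

(** Purity for infinite systems in countably many unknowns.  It is stronger than
    purity, but the closure constructions below yield it as easily, and it makes
    closure under the module operations automatic. *)
Definition countably_pure (A : lmodType R) (P : A -> Prop) :=
  forall v : nat -> A, exists w : nat -> A,
    [/\ forall i, P (w i), solves (relations_of v) w
      & forall i, P (v i) -> w i = v i].

Lemma countably_pure_submodule (A : lmodType R) (P : A -> Prop) :
  countably_pure P -> submodule P.
Proof.
move=> Ppure; split=> [|r x y Px Py].
  have [w [wP [wD _] _]] := Ppure (fun=> 0).
  have w0 := wD 0%N 0%N 0%N (addr0 _).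
  by rewrite (_ : 0 = w 0%N) //; apply/esym/(addrI (w 0%N)); rewrite addr0.
have [w [wP [wD wZ] w_id]] := Ppure (nth 0 [:: x; y; r *: x; r *: x + y]).
rewrite (_ : r *: x + y = w 3%N) // -(wD 2%N 1%N 3%N) // -(wZ r 0%N 2%N) //.
by rewrite (w_id 0%N) ?(w_id 1%N).
Qed.

Lemma countably_pure_pure (A : lmodType R) (P : A -> Prop) :
  countably_pure P -> pure_submodule P.
Proof.
move=> Ppure s rs.
pose t := s ++ [seq a + b | a <- s, b <- s] ++ [seq r *: a | r <- rs, a <- s].
have [w [wP [wD wZ] w_id]] := Ppure (nth 0 t).
have st a : a \in s -> a \in t by rewrite mem_cat => ->.
exists (fun a => w (index a t)); split=> [a|a as_ Pa|a b aS bS|r a rS aS].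
- exact: wP.
- by rewrite w_id nth_index ?st.
- have abt : a + b \in t.
    rewrite !mem_cat; apply/orP; right; apply/orP; left.
    exact: (allpairs_f (fun a b => a + b)).
  by apply/esym/wD; rewrite /= !nth_index //; apply: st.
- have rat : r *: a \in t.
    rewrite !mem_cat; apply/orP; right; apply/orP; right.
    exact: (allpairs_f (fun r a => r *: a)).
  by apply/esym/wZ; rewrite /= !nth_index //; apply: st.
Qed.

(** The set [{c - gamma c}] is the kernel of the retraction [c + b |-> gamma c + b] of
    [C + B] onto [B], hence a direct summand of a pure submodule.  In the proof,
    [delta] is the complementary projection, which kills [C] meet [B]. *)
Lemma countably_pure_retract_kernel (A : lmodType R) (C B : A -> Prop)
    (gamma : A -> A) :
  submodule C -> submodule B ->
  countably_pure (fun a => exists c b, [/\ C c, B b & a = c + b]) ->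
  (forall c, C c -> B (gamma c)) ->
  (forall c, C c -> B c -> gamma c = c) ->
  (forall r c c', C c -> C c' -> gamma (r *: c + c') = r *: gamma c + gamma c') ->
  countably_pure (fun a => exists2 c, C c & a = c - gamma c).
Proof.
move=> Csub Bsub CBpure gammaB gamma_id gammaL v.
pose delta c := c - gamma c.
have deltaL r c c' : C c -> C c' ->
    delta (r *: c + c') = r *: delta c + delta c'.
  by move=> Cc Cc'; rewrite /delta gammaL // opprD scalerBr addrACA.
have deltaD c c' : C c -> C c' -> delta (c + c') = delta c + delta c'.
  by move=> Cc Cc'; rewrite -[c in LHS]scale1r deltaL // scale1r.
have delta0 c : C c -> B c -> delta c = 0.
  by move=> Cc Bc; rewrite /delta gamma_id ?subrr.
have deltaZ r c : C c -> delta (r *: c) = r *: delta c.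
  have [C0 _] := Csub; have [B0 _] := Bsub => Cc.
  by rewrite -[r *: c]addr0 deltaL // (delta0 0) ?addr0.
have delta_eq c c' : C c -> C c' -> B (c - c') -> delta c = delta c'.
  move=> Cc Cc' Bcc'; rewrite -[c](subrK c') deltaD //; last exact: submoduleB.
  by rewrite delta0 ?add0r //; exact: submoduleB.
have [w [wCB [wD wZ] w_id]] := CBpure v.
have /choice[c cE] : forall i, exists c, C c /\ B (w i - c).
  by move=> i; have [c [b [Cc Bb ->]]] := wCB i; exists c; rewrite addrAC subrr add0r.
have Cc i : C (c i) by case: (cE i).
have Bc i : B (w i - c i) by case: (cE i).
exists (fun i => delta (c i)); split=> [i||i [c' Cc' vE]].
- by exists (c i).
- split=> /= [i j k /wD wijk|r i j /wZ wij].
    rewrite -deltaD //; apply: delta_eq => //; first exact: submoduleD.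
    have -> : c i + c j - c k = (w k - c k) - ((w i - c i) + (w j - c j)).
      by rewrite [(w i - c i) + _]addrACA -opprD wijk opprB [RHS]addrC addrA subrK.
    by apply: submoduleB => //; apply: submoduleD.
  rewrite -deltaZ //; apply: delta_eq => //; first exact: submoduleZ.
  have -> : r *: c i - c j = (w j - c j) - r *: (w i - c i).
    by rewrite scalerBr wij opprB [RHS]addrC addrA subrK.
  by apply: submoduleB => //; apply: submoduleZ.
- have wv : w i = v i.
    apply: w_id; exists c', (- gamma c'); split=> //.
    by apply: submoduleN => //; apply: gammaB.
  rewrite vE; apply: delta_eq => //.
  have -> : c i - c' = - gamma c' - (w i - c i).
    by rewrite wv vE !opprB addrCA addKr.
  by apply: submoduleB => //; apply: submoduleN => //; apply: gammaB.
Qed.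
End Relations.

(** * Bounding modules without pure submodules in a kernel *)

Section SmallGeneration.
Variables (R : pzRingType) (M : lmodType R).

(** Terms naming the elements of a small hull: [small_gen] stands for a generator, and
    [small_sol E J args rest i] for the [i]-th component of a chosen solution of [E]
    whose unknowns indexed by [J] are prescribed by [args]; see [eval_small]. *)
Inductive small_term :=
| small_gen (n : nat)
| small_sol (E : relations R nat) (J : nat -> Prop) (args : nat -> small_term)
    (rest : bool) (i : nat).

(** Terms naming the elements of the hull [decoded].  A [code_map] describes a map
    from [small_term] to the module by the relations it satisfies, its images in
    [M] and its values on [F], and selects one of its values.  The type depends
    on [R] and [M] only, and so bounds the hull independently of the module. *)
Inductive code :=
| code_zero
| code_map (E : relations R small_term) (m : small_term -> M)
    (F : small_term -> Prop) (args : small_term -> code) (t : small_term).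

Variables (A : lmodType R) (q : {linear A -> M}).

Fixpoint decode (k : code) : A :=
  if k is code_map E m F args t then
    xget (fun=> 0) [set g : small_term -> A | [/\ solves E g,
      forall t, q (g t) = m t & forall t, F t -> g t = decode (args t)]]%classic t
  else 0.

Definition decoded (a : A) := exists k, decode k = a.

(** Whatever small family [e] occurs in [A], a copy of it occurs in the hull: the
    pattern of [e] is a code, realised by [e] itself, hence by the chosen map. *)
Lemma decoded_saturated (e : small_term -> A) :
  exists g : small_term -> A,
  [/\ forall t, decoded (g t), solves (relations_of e) g,
      forall t, q (g t) = q (e t) & forall t, decoded (e t) -> g t = e t].
Proof.
have /choice[args argsE] : forall t, exists k, decoded (e t) -> decode k = e t.
  move=> t; have [[k kE]|n] := pselect (decoded (e t)); first by exists k.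
  by exists code_zero => /n.
pose k := code_map (relations_of e) (q \o e) (decoded \o e) args.
exists (fun t => decode (k t)).
pose G : set (small_term -> A) := [set g : small_term -> A |
  [/\ solves (relations_of e) g, forall t, q (g t) = (q \o e) t
    & forall t, (decoded \o e) t -> g t = decode (args t)]]%classic.
have [gD gq gF] : G (xget (fun=> 0) G).
  by apply: (xgetI _ (x := e)); split=> //= t /argsE.
split=> // [t|t dt]; first by exists (k t).
by rewrite /k /= gF //= argsE.
Qed.

(** A solution in [A] is a small family, of which [decoded] contains a copy with the
    same parameters. *)
Lemma decoded_countably_pure : countably_pure decoded.
Proof.
move=> v; pose e t := if t is small_gen n then v n else 0.
have [g [gB [gD gZ] _ g_id]] := decoded_saturated e.
exists (g \o small_gen); split=> [i||i vi] /=; first exact: gB.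
  split=> [i j k ijk|r i j ij].
    exact: (gD (small_gen i) (small_gen j) (small_gen k) ijk).
  exact: (gZ r (small_gen i) (small_gen j) ij).
exact: g_id.
Qed.

Section Span.
Variable c : A.

(** With [rest] false this is a hull for solving systems with parameters in the hull.
    With [rest] true, parameters are allowed an extra summand [p.2 j] in [decoded],
    and it is the summands making the system solvable that are chosen and added:
    they replace arbitrary parameters of [decoded] by parameters in the
    intersection with the hull. *)
Fixpoint eval_small (t : small_term) : A :=
  if t is small_sol E J args rest i then
    let p := xget (fun=> 0, fun=> 0) [set p : (nat -> A) * (nat -> A) |
      [/\ solves E p.1, forall j, J j -> p.1 j = eval_small (args j) + p.2 j
        & forall j, J j -> if rest then decoded (p.2 j) else p.2 j = 0]]%classic in
    if rest then p.2 i else p.1 i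
  else c.

Definition small_span (a : A) := exists t, eval_small t = a.

Lemma small_spanP E (J : nat -> Prop) (x v b : nat -> A) (rest : bool) :
  solves E v -> (forall j, J j -> small_span (x j)) ->
  (forall j, J j -> v j = x j + b j) ->
  (forall j, J j -> if rest then decoded (b j) else b j = 0) ->
  exists v' b', [/\ solves E v', forall j, J j -> v' j = x j + b' j,
    forall j, J j -> if rest then decoded (b' j) else b' j = 0
    & forall i, small_span (if rest then b' i else v' i)].
Proof.
move=> vE xS vx bJ.
have /choice[args argsE] : forall j, exists t, J j -> eval_small t = x j.
  move=> j; have [Jj|nJ] := pselect (J j); last by exists (small_gen 0) => /nJ.
  by have [t tE] := xS j Jj; exists t.
pose P : set ((nat -> A) * (nat -> A)) := [set p : (nat -> A) * (nat -> A) |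
      [/\ solves E p.1, forall j, J j -> p.1 j = eval_small (args j) + p.2 j
        & forall j, J j -> if rest then decoded (p.2 j) else p.2 j = 0]]%classic.
have [pE pJ pb] : P (xget (fun=> 0, fun=> 0) P).
  by apply: (xgetI _ (x := (v, b))); split=> //= j Jj; rewrite argsE // vx.
exists (xget (fun=> 0, fun=> 0) P).1, (xget (fun=> 0, fun=> 0) P).2.
split=> // [j Jj|i]; first by rewrite pJ // argsE.
by exists (small_sol E J args rest i).
Qed.

Lemma small_span_countably_pure : countably_pure small_span.
Proof.
move=> v; have [|w [b [wE wv wb wS]]] := @small_spanP (relations_of v)
  (fun j => small_span (v j)) v v (fun=> 0) false (solves_relations_of v)
  (fun _ => id) (fun j _ => esym (addr0 (v j))).
  by [].
by exists w; split=> // i vi; rewrite wv // wb // addr0.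
Qed.

(** For a system with parameters [x j + b j], the hull provides parameters
    [x j + b' j] with [b' j] in both hulls for which it is still solvable, by [v'].
    It remains to solve two systems: one with parameters in the small hull, and one
    for [v - v'] with parameters [b j - b' j] in [decoded]. *)
Lemma small_span_plus_decoded :
  countably_pure (fun a => exists x b, [/\ small_span x, decoded b & a = x + b]).
Proof.
have spanB x y : small_span x -> small_span y -> small_span (x + y).
  exact: (submoduleD (countably_pure_submodule small_span_countably_pure)).
have decB x y : decoded x -> decoded y -> decoded (x - y).
  exact: (submoduleB (countably_pure_submodule decoded_countably_pure)).
move=> v; pose J j := exists x b, [/\ small_span x, decoded b & v j = x + b].
have /choice[x xE] : forall j, exists x, J j -> small_span x /\ decoded (v j - x).
  move=> j; have [[x [b [xS bB ->]]]|nJ] := pselect (J j); last by exists 0 => /nJ.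
  by exists x; rewrite addrAC subrr add0r.
have [|||v' [b' [v'E v'J b'J b'S]]] := @small_spanP (relations_of v) J x v
    (fun j => v j - x j) true (solves_relations_of v).
- by move=> j /xE[].
- by move=> j _; rewrite subrKC.
- by move=> j /xE[].
have [y [yS yv' y_id]] := small_span_countably_pure v'.
have [z [zB zv z_id]] := decoded_countably_pure (fun j => v j - v' j).
exists (fun i => y i + z i); split=> [i||i Ji].
- by exists (y i), (z i).
- apply: solvesD; first exact: solves_trans yv'.
  apply: solves_trans zv; apply: solvesD => //.
  exact: solvesN.
- have [xS xB] := xE _ Ji; rewrite y_id ?z_id ?subrKC // v'J //.
    by rewrite opprD addrA; apply: decB => //; apply: b'J.
  by apply: spanB => //; apply: b'S.
Qed.

End Span.

(** If [c] lay outside [decoded], the copy [gamma] of its small hull in [decoded] would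
    give the pure submodule [{a - gamma a}] of [ker q], which contains the nonzero
    element [c - gamma c]. *)
Lemma reduced_decoded :
  (forall Q, pure_submodule_in (fun a => q a = 0) Q -> forall a, Q a -> a = 0) ->
  forall a, decoded a.
Proof.
move=> qred c.
have Csub := countably_pure_submodule (small_span_countably_pure c).
have Bsub := countably_pure_submodule decoded_countably_pure.
have [g [gB [gD gZ] gq g_id]] := decoded_saturated (eval_small c).
have /choice[term termE] : forall a, exists t, small_span c a -> eval_small c t = a.
  move=> a; have [[t tE]|n] := pselect (small_span c a); first by exists t.
  by exists (small_gen 0) => /n.
pose gamma a := g (term a).
have gE t : gamma (eval_small c t) = g t.
  have := gZ 1 (term (eval_small c t)) t; rewrite /= !scale1r; apply.
  by apply: termE; exists t.
have gammaL r a a' : small_span c a -> small_span c a' ->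
    gamma (r *: a + a') = r *: gamma a + gamma a'.
  move=> aC a'C; have raC := submoduleZ r Csub aC.
  have [t tE] := raC; have [t' tE'] : small_span c (r *: a + a').
    exact: (submoduleD Csub raC a'C).
  rewrite -tE' gE; apply/esym; rewrite (gZ r (term a) t) /= ?tE ?termE //.
  by apply: gD; rewrite /= tE tE' termE.
have gamma_id a : small_span c a -> decoded a -> gamma a = a.
  by move=> [t <-] tB; rewrite gE g_id.
have Ppure := countably_pure_retract_kernel Csub Bsub
  (small_span_plus_decoded c) (fun a _ => gB (term a)) gamma_id gammaL.
have Cc : small_span c c by exists (small_gen 0).
have : c - gamma c = 0.
  apply: (qred (fun a => exists2 x, small_span c x & a = x - gamma x));
    last by exists c.
  split.
  - exact: countably_pure_submodule Ppure.
  - exact: countably_pure_pure Ppure.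
  - by move=> a [b bC ->]; rewrite linearB /gamma gq termE // subrr.
by move/eqP; rewrite subr_eq0 => /eqP ->; apply: gB.
Qed.

End SmallGeneration.

(** * The universal property of direct sums *)

Section DirectSumTheory.
Variables (R : pzRingType) (I : Type) (M : I -> lmodType R).
Implicit Types x y : direct_sum M.

Definition ds_coord x (i : I) : M i := val x i.

Lemma ds_ext x y : (forall i, ds_coord x i = ds_coord y i) -> x = y.
Proof. by move=> xy; apply/val_inj/functional_extensionality_dep. Qed.

Lemma ds_coordP i a x y :
  ds_coord (a *: x + y) i = a *: ds_coord x i + ds_coord y i.
Proof. by []. Qed.

Lemma ds_coordB i x y : ds_coord (x - y) i = ds_coord x i - ds_coord y i.
Proof. by []. Qed.

Definition ds_supported (s : seq {classic I}) x :=
  forall i, ds_coord x i <> 0 -> (i : {classic I}) \in s.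

Lemma ds_support_exists x : exists s, uniq s /\ ds_supported s x.
Proof.
case: x => x /= xfin; have xfin' := asboolW xfin.
have [s sE] := (@finite_seqP {classic I} _).1 xfin'.
exists (undup s); split; first exact: undup_uniq.
move=> i xi; rewrite mem_undup.
by have : [set` s]%classic (i : {classic I}) by rewrite -sE.
Qed.

Definition ds_in_fun i (m : M i) : direct_product M := fun j =>
  if pselect (i = j) is left e then eq_rect i (fun k => M k : Type) m j e else 0.

Lemma ds_in_fun_supp i (m : M i) : ds_in_fun m \in finsupp_pred (M := M).
Proof.
apply/asboolP; apply: (sub_finite_set _ (finite_set1 i)) => j /= mj.
apply: contrapT => ij; apply: mj; rewrite /ds_in_fun; case: pselect => // e.
by case: ij; rewrite /= e.
Qed.

Definition ds_in i (m : M i) : direct_sum M := DirectSum (ds_in_fun_supp m).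

Lemma ds_in_same i (m : M i) : ds_coord (ds_in m) i = m.
Proof.
rewrite /ds_coord /= /ds_in_fun; case: pselect => // e.
by rewrite (Prop_irrelevance e erefl).
Qed.

Lemma ds_in_other i j (m : M i) : i <> j -> ds_coord (ds_in m) j = 0.
Proof. by rewrite /ds_coord /= /ds_in_fun; case: pselect. Qed.

Lemma ds_in_linear i a (m m' : M i) : ds_in (a *: m + m') = a *: ds_in m + ds_in m'.
Proof.
apply: ds_ext => j; rewrite ds_coordP.
have [<-|ij] := pselect (i = j); first by rewrite !ds_in_same.
by rewrite !ds_in_other // scaler0 addr0.
Qed.

Lemma ds_ind (P : direct_sum M -> Prop) :
  P 0 -> (forall x y, P x -> P y -> P (x + y)) ->
  (forall i (m : M i), P (ds_in m)) -> forall x, P x.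
Proof.
move=> P0 PD Pin x; have [s [_]] := ds_support_exists x.
elim: s x => [|i s IHs] x xs.
  rewrite (_ : x = 0) //; apply: ds_ext => i; apply: contrapT => /xs.
  by rewrite in_nil.
rewrite -[x](subrKC (ds_in (ds_coord x i))); apply: PD => //; apply: IHs => j.
rewrite ds_coordB; have [<-|ij] := pselect (i = j).
  by rewrite ds_in_same subrr.
rewrite ds_in_other // subr0 => /xs; rewrite inE => /predU1P[ji|//].
by case: ij.
Qed.

Lemma ds_linear_ext (Y : lmodType R) (f g : {linear direct_sum M -> Y}) :
  (forall i (m : M i), f (ds_in m) = g (ds_in m)) -> f =1 g.
Proof.
move=> fg; apply: ds_ind => [|x y fx fy|//]; first by rewrite !linear0.
by rewrite !linearD fx fy.
Qed.

(** The sum of the [f i] over the support of [x] may be taken over any duplicate-free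
    list containing it, which gives linearity. *)
Lemma ds_lift_exists (Y : lmodType R) (f : forall i, {linear M i -> Y}) :
  exists h : {linear direct_sum M -> Y},
    forall i (m : M i), h (ds_in m) = f i m.
Proof.
pose sum (s : seq {classic I}) x := \sum_(i <- s) f i (ds_coord x i).
have sum_sub s t x : uniq s -> uniq t -> {subset s <= t} ->
    ds_supported s x -> sum t x = sum s x.
  move=> us ut st xs; rewrite /sum (bigID (fun i => i \in s)) /=.
  rewrite [X in _ + X]big1 ?addr0 => [|i iNs]; last first.
    rewrite (_ : ds_coord x i = 0) ?linear0 //; apply: contrapT => /xs.
    exact/negP.
  rewrite -big_filter; apply: perm_big; apply: uniq_perm => //.
    exact: filter_uniq.
  by move=> i; rewrite mem_filter andb_idr //; apply: st.
have /choice[supp suppE] := ds_support_exists.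
have hl : linear (fun x => sum (supp x) x).
  move=> a x y; pose t := undup (supp x ++ supp y ++ supp (a *: x + y)).
  have tE z : {subset supp z <= t} -> sum (supp z) z = sum t z.
    move=> zt; have [uz zs] := suppE z.
    by rewrite (sum_sub (supp z) t) // undup_uniq.
  rewrite !tE /sum; last first.
  - by move=> i iz; rewrite mem_undup !mem_cat iz ?orbT.
  - by move=> i iz; rewrite mem_undup !mem_cat iz ?orbT.
  - by move=> i iz; rewrite mem_undup !mem_cat iz ?orbT.
  rewrite scaler_sumr -big_split; apply: eq_bigr => i _.
  by rewrite ds_coordP linearP.
have [h hE] := linear_map_of hl.
exists h => i m; rewrite hE; have [us ss] := suppE (ds_in m).
have [si|nsi] := boolP ((i : {classic I}) \in supp (ds_in m)).
  rewrite (sum_sub [:: (i : {classic I})]) //.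
  - by rewrite /sum big_seq1 ds_in_same.
  - by move=> j; rewrite inE => /eqP ->.
  move=> j mj; rewrite inE; apply/eqP; apply: contrapT => ji; apply: mj.
  by rewrite ds_in_other // => ij; apply: ji.
have m0 : m = 0.
  by apply: contrapT => m0; move/negP: nsi; apply; apply: ss; rewrite ds_in_same.
rewrite m0 linear0 /sum big1 // => j _.
rewrite (_ : ds_coord _ _ = 0) ?linear0 //.
have [<-|ij] := pselect (i = j); first by rewrite ds_in_same.
by rewrite ds_in_other.
Qed.

End DirectSumTheory.

(** * Precovers and direct sums *)

Lemma ds_in_linear_exists (R : pzRingType) (I : Type) (M : I -> lmodType R) i :
  exists f : {linear M i -> direct_sum M}, forall m, f m = ds_in m.
Proof. by apply: linear_map_of => a m m'; apply: ds_in_linear. Qed.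

Section Precovers.
Variables (R : pzRingType) (F : lmodType R -> Prop).

(** A precover of the direct sum splits, because it factors the inclusion of each
    summand. *)
Lemma precovering_direct_sum :
  closed_pure_quotient F -> precovering F -> closed_direct_sum F.
Proof.
move=> F_pq F_pre I M FM; have [X [p [FX pX]]] := F_pre (direct_sum M).
have hex i : exists h : {linear M i -> X}, forall m, p (h m) = ds_in m.
  have [f fE] := ds_in_linear_exists M i.
  by have [h hf] := pX _ f (FM i); exists h => m; rewrite -fE -hf.
have [s sE] := ds_lift_exists (fun i => projT1 (cid (hex i))).
have psK x : p (s x) = x.
  move: x; apply: (ds_linear_ext (f := p \o s) (g := idfun)) => i m /=.
  by rewrite sE (projT2 (cid (hex i))).
apply: (F_pq X) => //; apply: (@pure_kernel_quotient _ _ _ p) => [c|].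
  by exists (s c).
apply: locally_split_pure => l.
have [|rho rhoE] := @linear_map_of _ _ _ (fun x => x - s (p x)).
  by move=> a x y; rewrite !linearP addrACA scalerDr.
exists rho; split=> [a|a _ pa]; rewrite rhoE; first by rewrite linearB psK subrr.
by rewrite pa linear0 subr0.
Qed.

Lemma bijective_of_linear (A B : lmodType R) (f : {linear A -> B}) :
  (forall a, f a = 0 -> a = 0) -> (forall b, exists a, f a = b) -> bijective f.
Proof.
move=> f0 /choice[g gE]; exists g => // a; apply/eqP.
by rewrite -subr_eq0; apply/eqP/f0; rewrite linearB gE subrr.
Qed.

(** Up to isomorphism, the reduced sources of maps from [F] to [M] are quotients of the
    free module [Phi] on the codes, so that these maps form a set [small_map]. *)
Lemma direct_sum_precovering : closed_iso F -> closed_pure_quotient F ->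
  closed_direct_sum F -> precovering F.
Proof.
move=> F_iso F_pq F_sum M.
pose Phi := direct_sum (fun _ : code M => R^o : lmodType R).
pose small_map := {P : Phi -> Prop & {Psub : submodule P &
  {f : {linear module_quotient Psub -> M} | F (module_quotient Psub)}}}.
pose dom (i : small_map) : lmodType R := module_quotient (projT1 (projT2 i)).
pose map_ (i : small_map) : {linear dom i -> M} := sval (projT2 (projT2 i)).
have Fdom i : F (dom i) by case: i => P [Psub [f Ff]].
have [p pE] := ds_lift_exists map_.
exists (direct_sum dom), p; split=> [|X q FX]; first exact: F_sum.
have [C [g [q' [XC q'E qred]]]] := pure_reduction q.
have FC : F C by apply: F_pq XC FX.
have Csurj := reduced_decoded qred.
have /choice[u uE] : forall k : code M, exists u : {linear R^o -> C},
    forall r, u r = (r : R) *: decode q' k.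
  by move=> k; apply: linear_map_of => a r s; rewrite scalerDl scalerA.
have [pi piE] := ds_lift_exists u.
have pi_surj c : exists a, pi a = c.
  have [k <-] := Csurj c; exists (ds_in (1 : R^o) (i := k)).
  by rewrite piE uE scale1r.
have [v [v_surj vK]] := quotient_map (kernel_submodule pi).
have [t tE] : exists t : {linear C -> module_quotient (kernel_submodule pi)},
    forall a, t (pi a) = v a.
  by apply: factor_through_surjection => // a /vK.
have FQ : F (module_quotient (kernel_submodule pi)).
  apply: (F_iso _ _ t) FC; apply: bijective_of_linear => [c|b].
    by have [a <-] := pi_surj c; rewrite tE => /vK.
  by have [a <-] := v_surj b; exists (pi a); rewrite tE.
have [f fE] : exists f : {linear module_quotient (kernel_submodule pi) -> M},
    forall a, f (v a) = (q' \o pi) a.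
  by apply: factor_through_surjection => // a /vK /= ->; rewrite linear0.
pose i : small_map :=
  existT _ _ (existT _ (kernel_submodule pi) (exist _ f FQ)).
have [inj injE] := ds_in_linear_exists dom i.
exists (inj \o (t \o g)) => x /=; rewrite injE pE /map_ /=.
by have [a ga] := pi_surj (g x); rewrite -ga tE fE /= ga q'E.
Qed.

End Precovers.

(** * Directed colimits and Zorn's lemma *)

Section Colimit.
Variables (R : pzRingType) (F : lmodType R -> Prop).
Hypotheses (F_pq : closed_pure_quotient F) (F_sum : closed_direct_sum F).
Variables (X M : lmodType R) (p : {linear X -> M}).
Hypothesis FX : F X.
Variables (W : Type) (w0 : W) (le : W -> W -> Prop)
  (phi : W -> W -> {linear X -> X}).
Hypotheses (le_refl : forall i, le i i)
  (le_trans : forall i j k, le i j -> le j k -> le i k)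
  (le_directed : forall i j, exists k, le i k /\ le j k)
  (phi_comp : forall i j k x, le i j -> le j k ->
     phi j k (phi i j x) = phi i k x)
  (p_phi : forall i j x, le i j -> p (phi i j x) = p x).

Let Sum := direct_sum (fun _ : W => X).
Let inj i (x : X) : Sum := @ds_in _ _ (fun _ => X) i x.

(* [r w] projects the direct sum onto the relations visible at stage [w]: it subtracts
   from each component of index below [w] its image at [w], and forgets the others. *)
Let r_exists w : exists r : {linear Sum -> Sum}, forall i x,
  r (inj i x) = if pselect (le i w) then inj i x - inj w (phi i w x) else 0.
Proof.
have f_ex i : exists f : {linear X -> Sum}, forall x,
    f x = if pselect (le i w) then inj i x - inj w (phi i w x) else 0.
  apply: (@linear_map_of _ _ _
    (fun x => if pselect (le i w) then inj i x - inj w (phi i w x) else 0)).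
  move=> a x y; case: pselect => iw; last by rewrite scaler0 addr0.
  by rewrite /inj linearP !ds_in_linear opprD addrACA scalerBr.
have [r rE] := ds_lift_exists (fun i => projT1 (cid (f_ex i))).
by exists r => i x; rewrite rE (projT2 (cid (f_ex i))).
Qed.

(** The colimit of a directed system of copies of [X] is the quotient of their direct
    sum by the union [L] of the ranges of the projections [r w].  This union is
    directed, so that each finite part of [L] is fixed by one [r w]: hence [L] is
    pure. *)
Lemma directed_colimit_exists :
  exists (C : lmodType R) (q : {linear C -> M}) (psi : W -> {linear X -> C}),
  [/\ F C, forall i x, q (psi i x) = p x,
      forall i j x, le i j -> psi j (phi i j x) = psi i x
    & forall c, exists i x, psi i x = c].
Proof.
have /choice[r rE] := r_exists.
have r_in i w x : le i w -> r w (inj i x) = inj i x - inj w (phi i w x).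
  by move=> iw; rewrite rE; case: pselect.
have r_mono v w a : le v w -> r w (r v a) = r v a.
  move=> vw; move: a; apply: (ds_linear_ext (f := r w \o r v) (g := r v)) => i x.
  rewrite /= -[ds_in _]/(inj i x) rE; case: pselect => iv; last by rewrite linear0.
  rewrite linearB !r_in //; last exact: le_trans vw.
  by rewrite phi_comp // opprB addrA subrK.
pose L a := exists w, r w a = a.
have capture (s : seq Sum) : exists w, forall a, a \in s -> L a -> r w a = a.
  elim: s => [|a s [w ws]]; first by exists w0.
  have [[v va]|nL] := pselect (L a); last first.
    by exists w => b; rewrite inE => /predU1P[-> /nL //|]; exact: ws.
  have [k [vk wk]] := le_directed v w; exists k => b.
  rewrite inE => /predU1P[-> _|bs /(ws _ bs) <-]; last exact: r_mono.
  by rewrite -va r_mono.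
have Lsub : submodule L.
  split=> [|a x y Lx Ly]; first by exists w0; rewrite linear0.
  have [w wxy] := capture [:: x; y]; exists w.
  by rewrite linearP !wxy // !inE eqxx ?orbT.
have Lpure : pure_submodule L.
  apply: locally_split_pure => s; have [w ws] := capture s.
  by exists (r w); split=> // a; exists w; apply: r_mono.
have [g [gsurj gK]] := quotient_map Lsub.
have [P PE] := @ds_lift_exists _ _ (fun _ : W => X) _ (fun _ => p).
have Pr w a : P (r w a) = 0.
  move: a; apply: (ds_linear_ext (f := P \o r w) (g := \0)) => i x /=.
  rewrite -[ds_in _]/(inj i x) rE; case: pselect => iw; last by rewrite linear0.
  by rewrite linearB !PE p_phi // subrr.
have [q qE] : exists q : {linear module_quotient Lsub -> M}, forall a, q (g a) = P a.
  by apply: factor_through_surjection => // a /gK[w <-]; apply: Pr.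
have /choice[psi psiE] : forall i, exists psi : {linear X -> module_quotient Lsub},
    forall x, psi x = g (inj i x).
  by move=> i; apply: linear_map_of => a x y; rewrite /inj ds_in_linear linearP.
have psi_phi i j x : le i j -> psi j (phi i j x) = psi i x.
  move=> ij; apply/esym/eqP; rewrite !psiE -subr_eq0 -linearB; apply/eqP/gK.
  by exists j; rewrite -r_in // r_mono.
exists (module_quotient Lsub), q, psi; split=> //.
- have FS : F Sum by apply: F_sum.
  apply: F_pq FS; apply: pure_kernel_quotient gsurj _.
  by rewrite (_ : (fun a => g a = 0) = L) //; apply/funext => a; apply/propext/gK.
- by move=> i x; rewrite psiE qE PE.
move=> c; have [a <-] := gsurj c; move: a.
apply: ds_ind => [|a b [i [x ix]] [j [y jy]]|i x].
- by exists w0, 0; rewrite !linear0.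
- have [k [ik jk]] := le_directed i j.
  exists k, (phi i k x + phi j k y).
  by rewrite !linearD !psi_phi // ix jy.
- by exists i, x; rewrite psiE.
Qed.

End Colimit.

(** Zorn's lemma for structures on [I], given by values [s i j] and a condition [Q] on
    triples that only looks at the values among them: if any structure on a proper part
    of [I] can be prolonged to any new point, there is a structure on all of [I]. *)
Lemma total_structure (I T : Type) (t0 : T)
    (Q : (I -> I -> T) -> I -> I -> I -> Prop) :
  (forall s s' i j k,
     (forall a b, a = i \/ a = j \/ a = k -> b = i \/ b = j \/ b = k ->
        s a b = s' a b) -> Q s i j k -> Q s' i j k) ->
  (forall (D : set I) s d,
     (forall i j k, D i -> D j -> D k -> Q s i j k) -> ~ D d ->
     exists s', (forall i j, D i -> D j -> s i j = s' i j) /\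
       let D' i := D i \/ i = d in
       forall i j k, D' i -> D' j -> D' k -> Q s' i j k) ->
  exists s, forall i j k, Q s i j k.
Proof.
move=> Qloc Qext.
pose good (D : set I) s := forall i j k, D i -> D j -> D k -> Q s i j k.
pose part := {t : set I * (I -> I -> T) | good t.1 t.2}.
pose below (t u : part) := `[< ((sval t).1 `<=` (sval u).1)%classic /\
  forall i j, (sval t).1 i -> (sval t).1 j -> (sval t).2 i j = (sval u).2 i j >].
have empty : good set0 (fun _ _ => t0) by [].
have [|t u v /asboolP[tu tuE] /asboolP[uv uvE]|A Atot|t tmax] :=
  @ZL_preorder part (exist _ (_, _) empty) below.
- by move=> t; apply/asboolP; split.
- apply/asboolP; split=> [i ti|i j ti tj]; first exact/uv/tu.
  by rewrite tuE ?uvE //; apply: tu.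
- pose D i := exists2 t, A t & (sval t).1 i.
  have Acompat t u i j : A t -> A u -> (sval t).1 i -> (sval t).1 j ->
      (sval u).1 i -> (sval u).1 j -> (sval t).2 i j = (sval u).2 i j.
    move=> At Au ti tj ui uj.
    by have [/asboolP[_ E]|/asboolP[_ E]] := Atot _ _ At Au; rewrite E.
  have /choice[s sE] : forall ij : I * I, exists x, forall t, A t ->
      (sval t).1 ij.1 -> (sval t).1 ij.2 -> (sval t).2 ij.1 ij.2 = x.
    move=> [i j] /=.
    have [[t [At ti tj]]|nt] :=
        pselect (exists t, [/\ A t, (sval t).1 i & (sval t).1 j]).
      by exists ((sval t).2 i j) => u Au ui uj; apply: Acompat.
    by exists t0 => t At ti tj; case: nt; exists t.
  have Adir t u : A t -> A u -> exists v, [/\ A v,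
      ((sval t).1 `<=` (sval v).1)%classic & ((sval u).1 `<=` (sval v).1)%classic].
    move=> At Au; have [/asboolP[E _]|/asboolP[E _]] := Atot _ _ At Au.
      by exists u; split=> // x.
    by exists t; split=> // x.
  have goodD : good D (fun i j => s (i, j)).
    move=> i j k [ti Ati tii] [tj Atj tjj] [tk Atk tkk].
    have [u [Au iu ju]] := Adir _ _ Ati Atj; have [v [Av uv kv]] := Adir _ _ Au Atk.
    apply: (Qloc (sval v).2) => [a b abv bbv|].
      have vin x : x = i \/ x = j \/ x = k -> (sval v).1 x.
        by case=> [->|[->|->]]; [apply/uv/iu|apply/uv/ju|apply: kv].
      by apply: (sE (a, b)) => //; apply: vin.
    by apply: (svalP v); [apply/uv/iu|apply/uv/ju|apply: kv].
  exists (exist _ (D, fun i j => s (i, j)) goodD) => t At; apply/asboolP.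
  by split=> [i ti|i j ti tj] /=; [exists t|apply: (sE (i, j))].
exists (sval t).2; case: t tmax => -[D s] /= Dgood tmax i j k.
have DT d : D d.
  apply: contrapT => nDd; have [s' [ss' s'good]] := Qext D s d Dgood nDd.
  pose u : part := exist _ ((fun i => D i \/ i = d) : set I, s') s'good.
  have /tmax/asboolP[/= DD _] : below (exist _ (D, s) Dgood) u.
    by apply/asboolP; split=> //= i' Di'; left.
  by apply/nDd/DD; right.
by apply: (Dgood i j k); apply: DT.
Qed.

(** Cantor's diagonal argument. *)
Lemma no_injection_of_powerset (Y : Type) (f : set Y -> Y) : ~ injective f.
Proof.
move=> finj; pose B : set Y := fun y => exists2 A, f A = y & ~ A y.
have nB : ~ B (f B) by move=> BfB; have [A /finj AB] := BfB; rewrite AB.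
by apply: (nB); exists B.
Qed.

(** * Covers *)

Section Covers.
Variables (R : pzRingType) (F : lmodType R -> Prop).
Hypotheses (F_pq : closed_pure_quotient F) (F_sum : closed_direct_sum F).
Variable M : lmodType R.

Section Endomorphisms.
Variables (X : lmodType R) (p : {linear X -> M}).
Hypothesis p_precover : is_precover F p.

Definition over (e : X -> X) := forall x, p (e x) = p x.

Record chain (W : Type) (le : W -> W -> Prop) (phi : W -> W -> {linear X -> X}) :=
  Chain {
    chain_total : forall i j, le i j \/ le j i;
    chain_trans : forall i j k, le i j -> le j k -> le i k;
    chain_comp : forall i j k x, le i j -> le j k ->
      phi j k (phi i j x) = phi i k x;
    chain_over : forall i j, le i j -> over (phi i j) }.

(** The colimit of the chain lies in [F], so the precover property maps it back to
    [X]. *)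
Lemma chain_cocone W le phi : @chain W le phi ->
  exists psi : W -> {linear X -> X}, (forall i, over (psi i)) /\
    forall i j x, le i j -> psi j (phi i j x) = psi i x.
Proof.
move=> [tot trans comp phi_over]; have [FX pX] := p_precover.
have [[w0 _]|noW] := pselect (exists w : W, True); last first.
  by exists (fun _ => idfun); split=> i; case: noW; exists i.
have le_refl i : le i i by case: (tot i i).
have directed i j : exists k, le i k /\ le j k.
  by have [ij|ji] := tot i j; [exists j|exists i].
have [C [q [psi [FC qpsi psi_phi _]]]] := directed_colimit_exists F_pq F_sum FX
  w0 le_refl trans directed comp (fun i j x ij => phi_over i j ij x).
have [t tE] := pX C q FC.
exists (fun i => t \o psi i); split=> [i x|i j x ij] /=.
  by rewrite -[RHS](qpsi i) -tE.
by rewrite psi_phi.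
Qed.

(** A condition [strict] on consecutive maps that can be met one step beyond any
    endomorphism can be met along chains of arbitrary length.  The maps [eta i] play
    the role of the transition maps from a first copy of [X], in whose kernels
    growth is measured.  To prolong a chain by a new last point, take a cocone
    [psi] of it and follow it by the step [h] provided for the common composite
    [e] of the [psi i] with the [eta i]. *)
Lemma chain_exists (I : Type) (strict : (X -> X) -> (X -> X) -> Prop) :
  (forall e : {linear X -> X}, over e -> exists2 h : {linear X -> X}, over h &
     forall eta psi : {linear X -> X}, over eta -> over psi ->
       psi \o eta =1 e -> strict eta (h \o psi)) ->
  exists (le : I -> I -> Prop) (phi : I -> I -> {linear X -> X})
    (eta : I -> {linear X -> X}),
  [/\ chain le phi, forall i, over (eta i),
      forall i j x, le i j -> phi i j (eta i x) = eta j x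
    & forall i j, le i j -> i <> j -> strict (eta i) (phi i j)].
Proof.
move=> strict_ext; pose idX : {linear X -> X} := idfun.
pose T : Type := (Prop * {linear X -> X} * {linear X -> X})%type.
pose le (s : I -> I -> T) i j := (s i j).1.1.
pose phi (s : I -> I -> T) i j := (s i j).1.2.
pose eta (s : I -> I -> T) i := (s i i).2.
pose Q s i j k :=
  [/\ le s i j \/ le s j i,
      le s i j -> le s j k -> le s i k /\
        forall x, phi s j k (phi s i j x) = phi s i k x,
      over (eta s i)
    & le s i j -> [/\ over (phi s i j),
        forall x, phi s i j (eta s i x) = eta s j x
      & i <> j -> strict (eta s i) (phi s i j)]].
have [||s sQ] := @total_structure I T (True, idX, idX) Q.
- move=> s s' i j k ss'; rewrite /Q /le /phi /eta.
  by rewrite !ss' //; auto.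
- move=> D s d Dgood nDd.
  have refl i : D i -> le s i i by move=> Di; have [[]] := Dgood i i i Di Di Di.
  have [psi [e [e_over psiE]]] : exists (psi : I -> {linear X -> X})
      (e : {linear X -> X}), over e /\ forall i, D i ->
      [/\ over (psi i), psi i \o eta s i =1 e & forall j, D j -> le s i j ->
          forall x, psi j (phi s i j x) = psi i x].
    have [[w Dw]|nD] := pselect (exists w, D w); last first.
      exists (fun _ => idX), idX; split=> // i Di.
      by case: nD; exists i.
    pose le' (i j : {i | D i}) := le s (sval i) (sval j).
    pose phi' (i j : {i | D i}) := phi s (sval i) (sval j).
    have ch : chain le' phi'.
      split=> [[i Di] [j Dj]|[i Di] [j Dj] [k Dk] ij jk
              |[i Di] [j Dj] [k Dk] x ij jk|[i Di] [j Dj] ij].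
      + by have [] := Dgood i j i Di Dj Di.
      + by have [_ /(_ ij jk)[]] := Dgood i j k Di Dj Dk.
      + by have [_ /(_ ij jk)[_ E] _ _] := Dgood i j k Di Dj Dk; exact: E.
      + by have [_ _ _ /(_ ij)[]] := Dgood i j i Di Dj Di.
    have [psi [psi_over psiE]] := chain_cocone ch.
    pose psi' i := if pselect (D i) is left Di then psi (exist _ i Di) else idX.
    have psi'E i (Di : D i) : psi' i = psi (exist _ i Di).
      rewrite /psi'; case: pselect => // Di'; congr (psi (exist _ _ _)).
      exact: Prop_irrelevance.
    exists psi', (psi' w \o eta s w); split=> [x|i Di] /=.
      rewrite (psi'E _ Dw) psi_over.
      by have [_ _ ->] := Dgood w w w Dw Dw Dw.
    rewrite (psi'E _ Di); split=> [//|x|j Dj ij x] /=.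
      rewrite (psi'E _ Dw).
      have [iw|wi] : le s i w \/ le s w i by have [] := Dgood i w i Di Dw Di.
        have [_ _ _ /(_ iw)[_ <- _]] := Dgood i w i Di Dw Di.
        by rewrite (psiE (exist _ i Di) (exist _ w Dw)).
      have [_ _ _ /(_ wi)[_ <- _]] := Dgood w i w Dw Di Dw.
      by rewrite (psiE (exist _ w Dw) (exist _ i Di)).
    by rewrite (psi'E _ Dj) (psiE (exist _ i Di) (exist _ j Dj)).
  have [h h_over hS] := strict_ext e e_over.
  pose s' i j : T :=
    if pselect (i = d) then
      if pselect (j = d) then (True, idX, (h \o e : {linear X -> X}))
      else (False, idX, idX)
    else if pselect (j = d) then (True, (h \o psi i : {linear X -> X}), idX)
    else s i j.
  have Dd i : D i -> i <> d by move=> Di id_; apply: nDd; rewrite -id_.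
  have s'dd : s' d d = (True, idX, (h \o e : {linear X -> X})).
    by rewrite /s'; case: pselect.
  have s'dD j : D j -> s' d j = (False, idX, idX).
    by move=> /Dd jd; rewrite /s'; case: pselect => // dn; case: pselect.
  have s'Dd i : D i -> s' i d = (True, (h \o psi i : {linear X -> X}), idX).
    by move=> /Dd id_; rewrite /s'; case: pselect => // dn; case: pselect.
  have s'DD i j : D i -> D j -> s' i j = s i j.
    by move=> /Dd id_ /Dd jd; rewrite /s'; case: pselect => // dn; case: pselect.
  exists s'; split=> [i j Di Dj|]; first by rewrite s'DD.
  move=> D' i j k [Di|->] [Dj|->] [Dk|->]; rewrite /Q /le /phi /eta.
  + by rewrite !s'DD //; exact: Dgood.
  + rewrite !(s'Dd _ Di, s'Dd _ Dj) (s'DD _ _ Di Di) (s'DD _ _ Di Dj)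
      (s'DD _ _ Dj Di) (s'DD _ _ Dj Dj) /=.
    have [ij _ io ijP] := Dgood i j i Di Dj Di.
    split=> // lij _; split=> // x /=.
    by have [_ _ /(_ _ Dj lij) ->] := psiE i Di.
  + rewrite (s'Dd _ Di) (s'dD _ Di) (s'dD _ Dk) s'dd (s'DD _ _ Di Di) /=.
    have [_ _ io _] := Dgood i i i Di Di Di.
    have [psi_over psi_eta _] := psiE i Di.
    split=> //; first by left.
    move=> _; split=> [x|x|_] /=.
    - by rewrite h_over psi_over.
    - by rewrite -psi_eta.
    - exact: hS.
  + rewrite (s'Dd _ Di) (s'dD _ Di) s'dd (s'DD _ _ Di Di) /=.
    have [_ _ io _] := Dgood i i i Di Di Di.
    have [psi_over psi_eta _] := psiE i Di.
    split=> //; first by left.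
    move=> _; split=> [x|x|_] /=.
    - by rewrite h_over psi_over.
    - by rewrite -psi_eta.
    - exact: hS.
  + rewrite (s'Dd _ Dj) (s'dD _ Dj) (s'dD _ Dk) s'dd (s'DD _ _ Dj Dj) /=.
    by split=> // [|x]; [right|rewrite /= h_over].
  + rewrite (s'Dd _ Dj) (s'dD _ Dj) s'dd (s'DD _ _ Dj Dj) /=.
    by split=> // [|x]; [right|rewrite /= h_over].
  + rewrite (s'dD _ Dk) s'dd /=.
    by split=> // [|x]; [left|rewrite /= h_over].
  + rewrite s'dd /=.
    by split=> // [|x]; [left|rewrite /= h_over].
exists (le s), (phi s), (eta s); split.
- split=> [i j|i j k ij jk|i j k x ij jk|i j ij].
  + by have [] := sQ i j i.
  + by have [_ /(_ ij jk)[]] := sQ i j k.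
  + by have [_ /(_ ij jk)[_ ->]] := sQ i j k.
  + by have [_ _ _ /(_ ij)[]] := sQ i j i.
- by move=> i; have [] := sQ i i i.
- by move=> i j x ij; have [_ _ _ /(_ ij)[_ ->]] := sQ i j i.
- by move=> i j ij; have [_ _ _ /(_ ij)[]] := sQ i j i.
Qed.

(** Otherwise some chain indexed by [set (set X)] would have maps [eta i] with pairwise
    distinct kernels, and there are not enough subsets of [X]. *)
Lemma kernel_stable_endomorphism : exists2 e : {linear X -> X}, over e &
  forall h : {linear X -> X}, over h -> forall x, h (e x) = 0 -> e x = 0.
Proof.
apply: contrapT => none.
pose strict (eta phi : X -> X) := exists x, phi (eta x) = 0 /\ eta x <> 0.
have [e e_over|le [phi [eta [[tot _ _ _] _ phi_eta etaS]]]] :=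
  @chain_exists (set (set X)) strict.
  apply: contrapT => noh; apply: none; exists e => // h h_over x hex.
  apply: contrapT => ex0; apply: noh; exists h => // eta psi _ _ E.
  exists x; split=> /= [|ex]; first by move: (E x) => /= ->.
  by apply: ex0; rewrite -E /= ex linear0.
apply: (@no_injection_of_powerset (set X) (fun i x => eta i x = 0)) => i j kij.
apply: contrapT => ij.
wlog lij : i j kij ij / le i j.
  move=> wl; have [lij|lji] := tot i j; first exact: (wl i j).
  by apply: (wl j i) => // ji; apply: ij.
have [x [xj xi]] := etaS i j lij ij; apply: xi.
have -> : (eta i x = 0) = (eta j x = 0) := congr1 (fun B : set X => B x) kij.
by rewrite -(phi_eta i).
Qed.

(** If [h] is not onto, neither is any [h \o psi], and there is a chain indexed by
    [set (set X)] none of whose transition maps is onto.  The injective maps of a cocone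
    then have pairwise distinct ranges in [X]. *)
Lemma surjective_of_injective :
  (forall h : {linear X -> X}, over h -> forall x, h x = 0 -> x = 0) ->
  forall h : {linear X -> X}, over h -> forall y, exists x, h x = y.
Proof.
move=> h_inj h0 h0_over; apply: contrapT => h0_nsurj.
pose strict (eta phi : X -> X) := ~ forall y, exists x, phi x = y.
have [e _|le [phi [eta [ch _ _ phiS]]]] := @chain_exists (set (set X)) strict.
  exists h0 => // eta psi _ _ _ surj; apply: h0_nsurj => y.
  by have [x <-] := surj y; exists (psi x).
have [psi [psi_over psi_phi]] := chain_cocone ch.
apply: (@no_injection_of_powerset (set X) (fun i y => exists x, psi i x = y)).
move=> i j rij; apply: contrapT => ij.
wlog lij : i j rij ij / le i j.
  move=> wl; have [lij|lji] := chain_total ch i j; first exact: (wl i j).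
  by apply: (wl j i) => // ji; apply: ij.
apply: (phiS i j lij ij) => y.
have [x] : exists x, psi i x = psi j y.
  have -> : (exists x, psi i x = psi j y) = (exists x, psi j x = psi j y) :=
    congr1 (fun B : set X => B (psi j y)) rij.
  by exists y.
rewrite -(psi_phi i j) // => xy; exists x.
apply/eqP; rewrite -subr_eq0; apply/eqP/(h_inj _ (psi_over j)).
by rewrite linearB xy subrr.
Qed.

End Endomorphisms.

(** Let [C] be the colimit of the iterates of a kernel-stable [e].  An element of [C]
    comes from some [e x], so a map from [C] over [M] that kills it kills [e x]
    after going back to [X]; stability then gives [e x = 0]. *)
Lemma cover_of_precover (X : lmodType R) (p : {linear X -> M}) :
  is_precover F p -> exists (C : lmodType R) (q : {linear C -> M}), is_cover F q.
Proof.
move=> p_pre; have [FX pX] := p_pre.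
have [e e_over e_stable] := kernel_stable_endomorphism p_pre.
have /choice[pw pwE] : forall n, exists f : {linear X -> X}, forall x, f x = iter n e x.
  elim=> [|n [f fE]]; first by exists idfun.
  by exists (e \o f) => x /=; rewrite fE.
have [|||||C [q [psi [FC qpsi psi_phi psi_surj]]]] :=
  @directed_colimit_exists _ _ F_pq F_sum X M p FX nat 0%N (fun i j => i <= j)%N
    (fun i j => pw (j - i)%N).
- by [].
- by move=> i j k; apply: leq_trans.
- by move=> i j; exists (maxn i j); rewrite leq_maxl leq_maxr.
- by move=> i j k x ij jk; rewrite !pwE -iterD addnBA // subnK.
- move=> i j x _; rewrite pwE; elim: (j - i)%N => //= n IHn.
  by rewrite e_over.
have q_pre : is_precover F q.
  split=> // X' q' FX'; have [h hE] := pX X' q' FX'.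
  by exists (psi 0%N \o h) => x /=; rewrite qpsi -hE.
exists C, q; split=> // h h_over.
have h_inj (k : {linear C -> C}) : over q k -> forall c, k c = 0 -> c = 0.
  move=> k_over c; have [n [x <-]] := psi_surj c.
  rewrite -(psi_phi n n.+1) // subSnn pwE /= => kx0.
  have [t tE] := pX C q FC.
  rewrite (e_stable (t \o k \o psi n.+1)) ?linear0 //=.
    by move=> y /=; rewrite -[p _]/((p \o t) _) tE k_over qpsi.
  by rewrite kx0 linear0.
apply: bijective_of_linear; first exact: h_inj.
exact: (surjective_of_injective q_pre h_inj).
Qed.

End Covers.

Theorem theorem2p5 (R : pzRingType) (F : lmodType R -> Prop)
    (F_iso : closed_iso F) (F_pq : closed_pure_quotient F) :
  (closed_direct_sum F <-> precovering F) /\ (precovering F <-> covering F).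
Proof.
split; split.
- exact: direct_sum_precovering.
- exact: precovering_direct_sum.
- move=> F_pre M; have [X [p p_pre]] := F_pre M.
  by apply: cover_of_precover p_pre => //; apply: precovering_direct_sum.
- by move=> F_cov M; have [X [p [p_pre _]]] := F_cov M; exists X, p.
Qed.
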